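(* The Cesàro operator $\mathcal C: VH(\mathbb D)\to VH(\mathbb D)$ satisfies: (i) $\sigma_{pt}(\mathcal C;VH(\mathbb D))=\emptyset$; (ii) $\sigma(\mathcal C;VH(\mathbb D))=\{0\}\cup\{\lambda\in\mathbb C: \operatorname{Re}\lambda>0\}$.
   Context: $\mathbb D$ is the open unit disc and $H(\mathbb D)$ the space of analytic functions on $\mathbb D$ (compact-open topology). Define $v(z)=1$ if $|z|\le 1-1/e$ and $v(z)=(-\log(1-|z|))^{-1}$ if $1-1/e\le|z|<1$, $v_k=v^k$ ($k\in\mathbb N$), and $H^\infty_{v_k}=\{f\in H(\mathbb D):\sup_{z\in\mathbb D}v_k(z)|f(z)|<\infty\}$ with this sup as norm. $VH(\mathbb D)=\bigcup_k H^\infty_{v_k}$ with the inductive limit topology (finest locally convex topology making the inclusions continuous). The Cesàro operator is $\mathcal C f(z)=\frac1z\int_0^z\frac{f(\zeta)}{1-\zeta}\,d\zeta$ for $z\neq0$, $\mathcal Cf(0)=f(0)$; it is a continuous operator on $VH(\mathbb D)$. For a locally convex space $X$ and continuous linear $T:X\to X$, the resolvent set $\rho(T;X)$ is the set of $\lambda\in\mathbb C$ such that $\lambda I-T$ is bijective on $X$ with continuous inverse; $\sigma(T;X)=\mathbb C\setminus\rho(T;X)$ is the spectrum, and the point spectrum $\sigma_{pt}(T;X)$ is the set of $\lambda$ for which $\lambda I-T$ is not injective. *)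

(* Defs.v *)
From Stdlib Require Import Reals.
From Coquelicot Require Import Coquelicot.
Open Scope R_scope.

Definition inD (z : C) : Prop := Cmod z < 1.

Definition analytic_D (f : C -> C) : Prop :=
  forall z : C, inD z -> ex_derive (K := C_AbsRing) (V := C_NormedModule) f z.

Definition v (z : C) : R :=
  if Rle_dec (Cmod z) (1 - exp (-1)) then 1 else / (- ln (1 - Cmod z)).

Definition v_k (k : nat) (z : C) : R := (v z) ^ k.

Definition wbound (k : nat) (f : C -> C) (M : R) : Prop :=
  forall z : C, inD z -> v_k k z * Cmod (f z) <= M.

Definition Hv (k : nat) (f : C -> C) : Prop := analytic_D f /\ exists M, wbound k f M.

(* VH(D) = union of the H^oo_{v_k}, k in N (N = {1,2,...}; the union is increasing,
   so including k = 0 would not change it). *)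
Definition VH (f : C -> C) : Prop := exists k : nat, (1 <= k)%nat /\ Hv k f.

(* Functions are identified when they agree on D. *)
Definition eqD (f g : C -> C) : Prop := forall z, inD z -> f z = g z.

Definition seminorm_VH (q : (C -> C) -> R) : Prop :=
  (forall f, VH f -> 0 <= q f) /\
  (forall f g, VH f -> VH g -> q (fun z => f z + g z)%C <= q f + q g) /\
  (forall (a : C) f, VH f -> q (fun z => a * f z)%C = Cmod a * q f).

(* Continuous seminorms for the locally convex inductive limit topology: a seminorm
   on VH(D) is continuous iff its restriction to each step H^oo_{v_k} is continuous,
   i.e. bounded by a constant times the norm of H^oo_{v_k}.  These seminorms generate
   the inductive limit topology. *)
Definition cont_seminorm_VH (q : (C -> C) -> R) : Prop :=
  seminorm_VH q /\
  forall k : nat, (1 <= k)%nat -> exists c : R, 0 <= c /\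
    forall f M, analytic_D f -> wbound k f M -> q f <= c * M.

(* A (linear) map S : VH(D) -> VH(D) is continuous iff for every continuous seminorm q,
   q o S is a continuous seminorm, i.e. bounded on each step by a multiple of its norm. *)
Definition continuous_VH (S : (C -> C) -> (C -> C)) : Prop :=
  forall q, cont_seminorm_VH q ->
  forall k : nat, (1 <= k)%nat -> exists c : R, 0 <= c /\
    forall f M, analytic_D f -> wbound k f M -> q (S f) <= c * M.

(* The Cesaro operator: Cf(z) = (1/z) int_0^z f(w)/(1-w) dw, the integral taken along the
   segment [0,z] (any path in D gives the same value), i.e.
   int_0^1 f(t z)/(1 - t z) z dt ; Cf(0) = f(0). *)
Definition cesaro (f : C -> C) (z : C) : C :=
  if Ceq_dec z 0 then f z
  else (/ z * RInt (V := C_R_CompleteNormedModule)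
                   (fun t : R => (f (RtoC t * z) / (1 - RtoC t * z) * z)%C) 0 1)%C.

Definition shiftop (lam : C) (T : (C -> C) -> (C -> C)) (f : C -> C) : C -> C :=
  fun z => (lam * f z - T f z)%C.

Definition resolvent_VH (T : (C -> C) -> (C -> C)) (lam : C) : Prop :=
  exists S : (C -> C) -> (C -> C),
    (forall g, VH g -> VH (S g)) /\
    (forall g, VH g -> eqD (shiftop lam T (S g)) g) /\
    (forall f, VH f -> eqD (S (shiftop lam T f)) f) /\
    continuous_VH S.

Definition spectrum_VH (T : (C -> C) -> (C -> C)) (lam : C) : Prop :=
  ~ resolvent_VH T lam.

Definition point_spectrum_VH (T : (C -> C) -> (C -> C)) (lam : C) : Prop :=
  exists f g, VH f /\ VH g /\ ~ eqD f g /\ eqD (shiftop lam T f) (shiftop lam T g).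

(* Main.v *)
Require Import Defs.
From Stdlib Require Import Reals ZArith Lra Lia ClassicalEpsilon FunctionalExtensionality.
From Coquelicot Require Import Coquelicot.
Open Scope R_scope.

(** If [lam f - C f = g] with [lam <> 0] and [a = 1 / lam], then [w = z (C f) (1 - z)^a]
    satisfies the Euler equation [z w' = a w + a z g (1 - z)^(a - 1)].

    For [g = 0] it forces [w] to be homogeneous of degree [a] along circles and radii.  On the
    positive radius either continuity at [0] (when [Re a <= 0]) or the logarithmic growth of
    [VH] against the factor [(1 - z)^a] (when [Re a > 0]) gives [w = 0], so [lam - C] is injective.

    When [Re a <= 0] the Euler equation is solved by [int_0^1 t^(-a) G(t z) dt], and the kernel
    [((1 - z) / (1 - t z))^(-a) / (1 - t z)] costs one logarithm: the inverse maps the step [k]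
    continuously to the step [k + 1].

    When [Re a > 0], membership of [f] in [VH] forces [w -> 0] at [1].  If [a] is not an integer,
    [w] is determined by [g], and a polynomial almost solution of [z w' = a w] with value [1] at [1]
    yields a bounded [g] outside the range.  If [a = n] is an integer, [g = z^(n-1)] is resonant.
    For [lam = 0], [C f = g] gives [f = (1 - z) (z g)'], which has a pole for [g = log (1 + z) / z].

    Analyticity in the definitions is mere complex differentiability, hence Goursat's theorem. *)

(** All that is used of [cesaro] is that z C f is the primitive of f / (1 - z) vanishing at 0 and
    that C f(0) = f(0). No continuity of complex derivatives is at hand, so this primitive needs
    Goursat, and the Euler integral is not differentiated under the integral sign: an integration by
    parts expresses it through integrals of a primitive. Homogeneous solutions are multiples of z^a,
    analytic at 0 only when a is a nonnegative integer. For Re a > 0 the growth of VH imposes the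
    condition w(1) = 0. If a is not an integer, nothing can be added to w to meet it, so one g whose
    solution has w(1) = 1 is out of reach. If a = n, multiples of z^n could repair the value at 1,
    and the obstruction is instead the coefficient of z^n on the right-hand side; hence two
    different constructions. For Re a <= 0 the logarithm lost by the inverse would be fatal on a
    single step but is harmless in the union of the steps. The inverse is picked by [epsilon], with
    no bound attached; injectivity identifies it on the disc with the solution for which the bound
    was proved. *)

Lemma Cmod_sub_sym (x y : C) : Cmod (x - y) = Cmod (y - x).
Proof. rewrite <- Cmod_opp. f_equal. ring. Qed.

Lemma Cmod_sub_triangle (x y z : C) : Cmod (x - z) <= Cmod (x - y) + Cmod (y - z).
Proof. replace (x - z)%C with ((x - y) + (y - z))%C by ring. apply Cmod_triangle. Qed.

Lemma Cmod_le_sub (x y : C) : Cmod x <= Cmod y + Cmod (x - y).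
Proof. replace x with (y + (x - y))%C at 1 by ring. apply Cmod_triangle. Qed.

Lemma Cmod_sub_0 (x y : C) : Cmod (x - y) = 0 -> x = y.
Proof. intros H. apply Cmod_eq_0 in H. replace x with (x - y + y)%C by ring. rewrite H. ring. Qed.

Lemma im_le_Cmod (c : C) : Rabs (Im c) <= Cmod c.
Proof. eapply Rle_trans; [apply Rmax_r | apply (Rmax_Cmod c)]. Qed.

Lemma RtoC_sub_mod (x y : R) : Cmod (RtoC x - RtoC y) = Rabs (x - y).
Proof. rewrite <- RtoC_minus. apply Cmod_R. Qed.

Lemma C1_neq_0 : RtoC 1 <> RtoC 0.
Proof. intros H. apply RtoC_inj in H. lra. Qed.

(** * Continuity and derivatives along an embedded parameter *)

(* The parameter space X is C itself or the real line, embedded by i, so that the calculus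
   rules need only be proved once. *)
Definition cnt {X : Type} (i : X -> C) (f : X -> C) (x : X) : Prop :=
  forall eps, 0 < eps -> exists del, 0 < del /\
    forall y, Cmod (i y - i x) < del -> Cmod (f y - f x) < eps.

Definition der {X : Type} (i : X -> C) (f : X -> C) (x : X) (l : C) : Prop :=
  forall eps, 0 < eps -> exists del, 0 < del /\
    forall y, Cmod (i y - i x) < del ->
      Cmod (f y - f x - l * (i y - i x)) <= eps * Cmod (i y - i x).

Definition Ccnt := cnt (fun z : C => z).
Definition Cder := der (fun z : C => z).
Definition Rcnt := cnt RtoC.
Definition Rder := der RtoC.

Section Calculus.
Context {X : Type} (i : X -> C).

Lemma cnt_const (c : C) x : cnt i (fun _ => c) x.
Proof.
  intros e He. exists 1. split; [lra|]. intros y _.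
  replace (c - c)%C with (RtoC 0) by ring. rewrite Cmod_0. lra.
Qed.

Lemma cnt_embed x : cnt i i x.
Proof. intros e He. exists e. split; auto. Qed.

Lemma cnt_plus f g x : cnt i f x -> cnt i g x -> cnt i (fun y => f y + g y)%C x.
Proof.
  intros Hf Hg e He.
  destruct (Hf (e / 2)) as [d1 [Hd1 H1]]; [lra|].
  destruct (Hg (e / 2)) as [d2 [Hd2 H2]]; [lra|].
  exists (Rmin d1 d2). split; [now apply Rmin_glb_lt|]. intros y Hy.
  specialize (H1 y (Rlt_le_trans _ _ _ Hy (Rmin_l _ _))).
  specialize (H2 y (Rlt_le_trans _ _ _ Hy (Rmin_r _ _))).
  replace (f y + g y - (f x + g x))%C with ((f y - f x) + (g y - g x))%C by ring.
  eapply Rle_lt_trans; [apply Cmod_triangle|]. lra.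
Qed.

Lemma cnt_mult f g x : cnt i f x -> cnt i g x -> cnt i (fun y => f y * g y)%C x.
Proof.
  intros Hf Hg e He.
  assert (P := Cmod_ge_0 (f x)). assert (Q := Cmod_ge_0 (g x)).
  set (K := Cmod (f x) + Cmod (g x) + 1).
  assert (HK : 0 < K) by (unfold K; lra).
  assert (HeK : 0 < e / (2 * K)) by (apply Rdiv_lt_0_compat; lra).
  destruct (Hf (e / (2 * K)) HeK) as [d1 [Hd1 H1]].
  destruct (Hg (Rmin 1 (e / (2 * K)))) as [d2 [Hd2 H2]]; [apply Rmin_glb_lt; lra|].
  exists (Rmin d1 d2). split; [now apply Rmin_glb_lt|]. intros y Hy.
  specialize (H1 y (Rlt_le_trans _ _ _ Hy (Rmin_l _ _))).
  specialize (H2 y (Rlt_le_trans _ _ _ Hy (Rmin_r _ _))).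
  assert (H3 := Rlt_le_trans _ _ _ H2 (Rmin_l _ _)).
  assert (H4 := Rlt_le_trans _ _ _ H2 (Rmin_r _ _)).
  replace (f y * g y - f x * g x)%C with ((f y - f x) * g y + f x * (g y - g x))%C by ring.
  eapply Rle_lt_trans; [apply Cmod_triangle|]. rewrite !Cmod_mult.
  assert (Hg1 : Cmod (g y) <= K) by (assert (Hh := Cmod_le_sub (g y) (g x)); unfold K; lra).
  assert (Hf1 : Cmod (f x) <= K) by (unfold K; lra).
  assert (A1 : Cmod (f y - f x) * Cmod (g y) <= Cmod (f y - f x) * K)
    by (apply Rmult_le_compat_l; [apply Cmod_ge_0|auto]).
  assert (A2 : Cmod (f x) * Cmod (g y - g x) <= K * Cmod (g y - g x))
    by (apply Rmult_le_compat_r; [apply Cmod_ge_0|auto]).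
  assert (A3 : Cmod (f y - f x) * K < e / (2 * K) * K) by (apply Rmult_lt_compat_r; auto).
  assert (A4 : K * Cmod (g y - g x) < K * (e / (2 * K))) by (apply Rmult_lt_compat_l; auto).
  replace (e / (2 * K) * K) with (e / 2) in A3 by (field; lra).
  replace (K * (e / (2 * K))) with (e / 2) in A4 by (field; lra).
  lra.
Qed.

Lemma cnt_opp f x : cnt i f x -> cnt i (fun y => - f y)%C x.
Proof.
  intros H e He. destruct (H e He) as [d [Hd H1]]. exists d. split; auto. intros y Hy.
  replace (- f y - - f x)%C with (- (f y - f x))%C by ring. rewrite Cmod_opp. auto.
Qed.

Lemma cnt_minus f g x : cnt i f x -> cnt i g x -> cnt i (fun y => f y - g y)%C x.
Proof. intros Hf Hg. apply (cnt_plus f (fun y => - g y)%C); auto. now apply cnt_opp. Qed.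

Lemma cnt_comp f g x : cnt i g x -> Ccnt f (g x) -> cnt i (fun y => f (g y)) x.
Proof.
  intros Hg Hf e He. destruct (Hf e He) as [d1 [Hd1 H1]].
  destruct (Hg d1 Hd1) as [d2 [Hd2 H2]]. exists d2. split; auto.
Qed.

Lemma der_near_ext f g x l d : 0 < d -> (forall y, Cmod (i y - i x) < d -> f y = g y) ->
  der i f x l -> der i g x l.
Proof.
  intros Hd E H e He. destruct (H e He) as [d1 [Hd1 H1]].
  exists (Rmin d1 d). split; [now apply Rmin_glb_lt|]. intros y Hy.
  rewrite <- !E.
  - apply H1. eapply Rlt_le_trans; [exact Hy|apply Rmin_l].
  - replace (i x - i x)%C with (RtoC 0) by ring. rewrite Cmod_0. auto.
  - eapply Rlt_le_trans; [exact Hy|apply Rmin_r].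
Qed.

(** Carathéodory's form of the derivative: the slope extends continuously to the point. The rules
    for sums, products and compositions then become identities between slopes, with no division and
    no epsilon. *)
Lemma der_caratheodory f x l : der i f x l <->
  exists q, q x = l /\ cnt i q x /\ forall y, f y = (f x + q y * (i y - i x))%C.
Proof.
  split.
  - intros H.
    set (q := fun y => if Ceq_dec (i y) (i x) then l else ((f y - f x) / (i y - i x))%C).
    assert (qx : q x = l) by (unfold q; destruct (Ceq_dec (i x) (i x)); congruence).
    exists q. split; [exact qx|]. split.
    + intros e He. destruct (H (e / 2)) as [d [Hd H1]]; [lra|].
      exists d. split; auto. intros y Hy. rewrite qx. unfold q.
      destruct (Ceq_dec (i y) (i x)) as [E|E].
      { replace (l - l)%C with (RtoC 0) by ring. rewrite Cmod_0. auto. }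
      assert (N : (i y - i x)%C <> 0).
      { intros N. apply E. replace (i y) with (i y - i x + i x)%C by ring. rewrite N. ring. }
      replace ((f y - f x) / (i y - i x) - l)%C
        with ((f y - f x - l * (i y - i x)) / (i y - i x))%C by (field; auto).
      rewrite Cmod_div by auto.
      assert (P := proj1 (Cmod_gt_0 _) N). specialize (H1 y Hy).
      apply Rle_lt_trans with (e / 2); [|lra].
      apply Rmult_le_reg_r with (Cmod (i y - i x)); auto.
      unfold Rdiv at 1. rewrite Rmult_assoc, Rinv_l by lra. lra.
    + intros y. unfold q. destruct (Ceq_dec (i y) (i x)) as [E|E].
      (* The embedding [i] is not assumed injective: a point [y] with the same image as [x] has
         increment 0, and the derivative estimate itself forces f y = f x. *)
      * destruct (H 1) as [d [Hd H1]]; [lra|]. specialize (H1 y).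
        rewrite E in H1 |- *. replace (i x - i x)%C with (RtoC 0) in H1 |- * by ring.
        rewrite Cmod_0 in H1. specialize (H1 Hd).
        replace (f y - f x - l * 0)%C with (f y - f x)%C in H1 by ring.
        rewrite (Cmod_sub_0 (f y) (f x)); [ring|].
        assert (P := Cmod_ge_0 (f y - f x)). lra.
      * field. intros N. apply E. replace (i y) with (i y - i x + i x)%C by ring. rewrite N. ring.
  - intros [q [qx [Hq Hf]]] e He. destruct (Hq e He) as [d [Hd H1]].
    exists d. split; auto. intros y Hy. rewrite (Hf y).
    replace (f x + q y * (i y - i x) - f x - l * (i y - i x))%C
      with ((q y - q x) * (i y - i x))%C by (rewrite qx; ring).
    rewrite Cmod_mult. apply Rmult_le_compat_r; [apply Cmod_ge_0|]. left. auto.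
Qed.

Lemma der_cnt f x l : der i f x l -> cnt i f x.
Proof.
  rewrite der_caratheodory. intros [q [_ [Hq Hf]]].
  rewrite (functional_extensionality f _ Hf).
  apply cnt_plus; [apply cnt_const|]. apply cnt_mult; auto.
  apply cnt_minus; [apply cnt_embed|apply cnt_const].
Qed.

Lemma der_eq f x l l' : der i f x l -> l = l' -> der i f x l'.
Proof. intros H <-. exact H. Qed.

Lemma der_const (c : C) x : der i (fun _ => c) x 0.
Proof.
  apply der_caratheodory. exists (fun _ => RtoC 0). split; auto. split; [apply cnt_const|].
  intros; ring.
Qed.

Lemma der_embed x : der i i x 1.
Proof.
  apply der_caratheodory. exists (fun _ => RtoC 1). split; auto. split; [apply cnt_const|].
  intros; ring.
Qed.

Lemma der_plus f g x l m : der i f x l -> der i g x m ->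
  der i (fun y => f y + g y)%C x (l + m).
Proof.
  rewrite !der_caratheodory. intros [p [p1 [p2 p3]]] [q [q1 [q2 q3]]].
  exists (fun y => p y + q y)%C. split; [congruence|]. split; [now apply cnt_plus|].
  intros y. rewrite (p3 y), (q3 y). ring.
Qed.

Lemma der_mult f g x l m : der i f x l -> der i g x m ->
  der i (fun y => f y * g y)%C x (l * g x + f x * m).
Proof.
  intros Hf Hg. assert (Cg := der_cnt _ _ _ Hg). revert Hf Hg.
  rewrite !der_caratheodory. intros [p [p1 [p2 p3]]] [q [q1 [q2 q3]]].
  exists (fun y => p y * g y + f x * q y)%C. split; [congruence|]. split.
  - apply cnt_plus; apply cnt_mult; auto. apply cnt_const.
  - intros y. rewrite (p3 y), (q3 y). ring.
Qed.

Lemma der_scal (c : C) f x l : der i f x l -> der i (fun y => c * f y)%C x (c * l).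
Proof.
  intros H. eapply der_eq; [apply (der_mult (fun _ => c) f x); [apply der_const|exact H]|].
  cbv beta. ring.
Qed.

Lemma der_opp f x l : der i f x l -> der i (fun y => - f y)%C x (- l).
Proof.
  rewrite !der_caratheodory. intros [p [p1 [p2 p3]]].
  exists (fun y => - p y)%C. split; [congruence|]. split; [now apply cnt_opp|].
  intros y. rewrite (p3 y). ring.
Qed.

Lemma der_minus f g x l m : der i f x l -> der i g x m ->
  der i (fun y => f y - g y)%C x (l - m).
Proof. intros Hf Hg. apply (der_plus f (fun y => - g y)%C); auto. now apply der_opp. Qed.

End Calculus.

(** The slope of the composite is the product of the slopes, so points where the inner function
    repeats its value need no separate case. *)
Lemma der_comp {X} (i : X -> C) f g x l m : der i g x l -> Cder f (g x) m ->
  der i (fun y => f (g y)) x (m * l).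
Proof.
  intros Hg Hf. assert (Cg := der_cnt i _ _ _ Hg).
  apply der_caratheodory in Hg. destruct Hg as [q [q1 [q2 q3]]].
  assert (Hp : exists p, p (g x) = m /\ Ccnt p (g x) /\
    forall y, f y = (f (g x) + p y * (y - g x))%C).
  { apply (der_caratheodory (fun z : C => z)). exact Hf. }
  destruct Hp as [p [p1 [p2 p3]]].
  apply der_caratheodory. exists (fun y => p (g y) * q y)%C. split; [congruence|]. split.
  - apply cnt_mult; auto. apply cnt_comp; auto.
  - intros y. rewrite (p3 (g y)). rewrite (q3 y) at 2. ring.
Qed.

Lemma Ccnt_neq_0 {X} (i f : X -> C) x : cnt i f x -> f x <> 0 ->
  exists d, 0 < d /\ forall y, Cmod (i y - i x) < d -> f y <> 0.
Proof.
  intros H N. destruct (H (Cmod (f x))) as [d [Hd H1]]; [now apply Cmod_gt_0|].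
  exists d. split; auto. intros y Hy E. specialize (H1 y Hy). rewrite E in H1.
  replace (0 - f x)%C with (- f x)%C in H1 by ring. rewrite Cmod_opp in H1. lra.
Qed.

Lemma Cinv_cnt (z : C) : z <> 0 -> Ccnt Cinv z.
Proof.
  intros N e He. assert (P := proj1 (Cmod_gt_0 _) N).
  assert (Q : 0 < e * (Cmod z * Cmod z) / 2).
  { apply Rdiv_lt_0_compat; [|lra]. repeat apply Rmult_lt_0_compat; auto. }
  exists (Rmin (Cmod z / 2) (e * (Cmod z * Cmod z) / 2)). split.
  { apply Rmin_glb_lt; auto. lra. }
  intros y Hy. assert (Hy1 := Rlt_le_trans _ _ _ Hy (Rmin_l _ _)).
  assert (Hy2 := Rlt_le_trans _ _ _ Hy (Rmin_r _ _)).
  assert (My : Cmod z / 2 < Cmod y).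
  { assert (Hh := Cmod_le_sub z y). rewrite Cmod_sub_sym in Hh. lra. }
  assert (Ny : y <> 0) by (apply Cmod_gt_0; lra).
  replace (/ y - / z)%C with ((z - y) / (y * z))%C by (field; auto).
  assert (Nyz : (y * z)%C <> 0) by (now apply Cmult_neq_0).
  rewrite Cmod_div, Cmod_mult, Cmod_sub_sym by auto.
  apply Rmult_lt_reg_r with (Cmod y * Cmod z); [apply Rmult_lt_0_compat; lra|].
  unfold Rdiv. rewrite Rmult_assoc, Rinv_l, Rmult_1_r by (apply Rmult_integral_contrapositive; lra).
  eapply Rlt_le_trans; [exact Hy2|]. unfold Rdiv.
  rewrite Rmult_assoc. apply Rmult_le_compat_l; [lra|].
  nra.
Qed.

Lemma Cder_inv (z : C) : z <> 0 -> Cder Cinv z (- (/ (z * z))).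
Proof.
  intros N. assert (HC : Ccnt (fun y => - (/ z * / y))%C z).
  { apply cnt_opp. apply cnt_mult; [apply cnt_const|now apply Cinv_cnt]. }
  intros e He. destruct (HC e He) as [d [Hd H1]].
  destruct (Ccnt_neq_0 (fun z : C => z) _ z (cnt_embed _ z) N) as [d2 [Hd2 H2]].
  exists (Rmin d d2). split; [now apply Rmin_glb_lt|]. intros y Hy.
  specialize (H1 y (Rlt_le_trans _ _ _ Hy (Rmin_l _ _))).
  specialize (H2 y (Rlt_le_trans _ _ _ Hy (Rmin_r _ _))).
  cbv beta in H2.
  replace (/ y - / z - - / (z * z) * (y - z))%C
    with ((- (/ z * / y) - - (/ z * / z)) * (y - z))%C by (field; auto).
  rewrite Cmod_mult. apply Rmult_le_compat_r; [apply Cmod_ge_0|]. left. exact H1.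
Qed.

Lemma cnt_inv {X} (i f : X -> C) x : f x <> 0 -> cnt i f x -> cnt i (fun y => / f y)%C x.
Proof. intros N H. apply (cnt_comp i Cinv f); auto. apply Cinv_cnt. exact N. Qed.

Lemma der_inv {X} (i f : X -> C) x l : f x <> 0 -> der i f x l ->
  der i (fun y => / f y)%C x (- l / (f x * f x)).
Proof.
  intros N H. eapply der_eq.
  - apply (der_comp i Cinv f); eauto. apply Cder_inv. exact N.
  - field. auto.
Qed.

Lemma Cder_pow n (z : C) : Cder (fun z => z ^ n)%C z (INR n * z ^ (pred n))%C.
Proof.
  induction n as [|n IH].
  - simpl. eapply der_eq; [apply der_const|]. ring.
  - eapply der_eq; [apply (der_mult (fun z : C => z) (fun z => z) (fun z => z ^ n)%C); [apply der_embed|exact IH]|].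
    cbv beta. rewrite S_INR, RtoC_plus. destruct n; simpl; ring.
Qed.

(** * Comparison with the derivatives and continuity of Coquelicot *)

Lemma Cder_is_derive f z l : Cder f z l <-> is_derive (K := C_AbsRing) (V := C_NormedModule) f z l.
Proof.
  split.
  - intros H. split; [apply is_linear_scal_l|].
    intros x Hx. assert (E : x = z).
    { symmetry. apply (is_filter_lim_locally_unique (K := C_AbsRing) (V := AbsRing_NormedModule C_AbsRing) z x Hx). }
    subst x. intros e. destruct (H e (cond_pos e)) as [d [Hd H1]].
    exists (mkposreal d Hd). intros y Hy. specialize (H1 y Hy).
    change (Cmod (f y - f z - (y - z) * l) <= e * Cmod (y - z)).
    rewrite (Cmult_comm (y - z)). exact H1.
  - intros [_ H] e He. specialize (H z (fun P HP => HP) (mkposreal e He)).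
    destruct H as [d H1]. exists d. split; [apply cond_pos|]. intros y Hy.
    specialize (H1 y Hy).
    change (Cmod (f y - f z - (y - z) * l) <= e * Cmod (y - z)) in H1.
    rewrite Cmult_comm in H1. exact H1.
Qed.

Lemma norm_C_R (z : C) : @norm R_AbsRing C_R_NormedModule z = Cmod z.
Proof. symmetry. apply (Cmod_norm z). Qed.

Lemma Rcnt_continuous f t : Rcnt f t <-> continuous (U := C_R_NormedModule) f t.
Proof.
  split.
  - intros H. apply filterlim_locally. intros e. destruct (H e (cond_pos e)) as [d [Hd H1]].
    exists (mkposreal d Hd). intros s Hs.
    apply (norm_compat1 (K := R_AbsRing) (V := C_R_NormedModule)). rewrite norm_C_R. apply H1.
    rewrite RtoC_sub_mod. exact Hs.
  - intros H e He.
    assert (H0 := proj1 (filterlim_locally_ball_norm (K := R_AbsRing) (U := C_R_NormedModule) f (f t)) H (mkposreal e He)).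
    destruct H0 as [d H1]. exists d. split; [apply cond_pos|]. intros s Hs.
    rewrite RtoC_sub_mod in Hs. specialize (H1 s Hs). unfold ball_norm in H1.
    rewrite norm_C_R in H1. exact H1.
Qed.

Lemma Rder_is_derive f t l : Rder f t l -> is_derive (K := R_AbsRing) (V := C_R_NormedModule) f t l.
Proof.
  intros H. split; [apply is_linear_scal_l|].
  intros x Hx. assert (E : x = t).
  { symmetry. apply (is_filter_lim_locally_unique (K := R_AbsRing) (V := R_NormedModule) t x Hx). }
  subst x. intros e. destruct (H e (cond_pos e)) as [d [Hd H1]].
  exists (mkposreal d Hd). intros s Hs. specialize (H1 s).
  rewrite RtoC_sub_mod in H1. specialize (H1 Hs). rewrite norm_C_R.
  eapply Rle_trans; [|exact H1]. right.
  change (Cmod (f s - f t - (((s - t) * fst l)%R, ((s - t) * snd l)%R))%C = Cmod (f s - f t - l * (s - t))%C).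
  f_equal. rewrite <- RtoC_minus. unfold Cminus, Cplus, Copp, Cmult, RtoC; simpl. f_equal; ring.
Qed.

Lemma Rder_Re f t l : Rder f t l -> is_derive (fun t => Re (f t)) t (Re l).
Proof.
  intros H. split; [apply is_linear_scal_l|].
  intros x Hx. assert (E : x = t).
  { symmetry. apply (is_filter_lim_locally_unique (K := R_AbsRing) (V := R_NormedModule) t x Hx). }
  subst x. intros e. destruct (H e (cond_pos e)) as [d [Hd H1]].
  exists (mkposreal d Hd). intros s Hs. specialize (H1 s).
  rewrite RtoC_sub_mod in H1. specialize (H1 Hs).
  eapply Rle_trans; [|exact H1]. eapply Rle_trans; [|apply re_le_Cmod].
  right. change (Rabs (Re (f s) - Re (f t) - (s - t) * Re l) = Rabs (Re (f s - f t - l * (s - t)))).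
  f_equal. rewrite <- RtoC_minus. unfold Re, Cminus, Cplus, Copp, Cmult, RtoC; simpl. ring.
Qed.

Lemma Rder_pair (f g : R -> R) t l m : is_derive f t l -> is_derive g t m ->
  Rder (fun t => (f t, g t)) t (l, m).
Proof.
  intros Hf Hg e He.
  destruct Hf as [_ Hf]. destruct Hg as [_ Hg].
  specialize (Hf t (fun P HP => HP)). specialize (Hg t (fun P HP => HP)).
  assert (He2 : 0 < e / 2) by lra.
  destruct (Hf (mkposreal _ He2)) as [d1 H1]. destruct (Hg (mkposreal _ He2)) as [d2 H2].
  exists (Rmin d1 d2). split; [apply Rmin_glb_lt; apply cond_pos|]. intros s Hs.
  rewrite RtoC_sub_mod in Hs |- *.
  specialize (H1 s (Rlt_le_trans _ _ _ Hs (Rmin_l _ _))).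
  specialize (H2 s (Rlt_le_trans _ _ _ Hs (Rmin_r _ _))).
  change (Rabs (f s - f t - (s - t) * l) <= e / 2 * Rabs (s - t)) in H1.
  change (Rabs (g s - g t - (s - t) * m) <= e / 2 * Rabs (s - t)) in H2.
  set (A := f s - f t - (s - t) * l) in *. set (B := g s - g t - (s - t) * m) in *.
  replace ((f s, g s) - (f t, g t) - (l, m) * (s - t))%C with (RtoC A + Ci * RtoC B)%C.
  - eapply Rle_trans; [apply Cmod_triangle|]. rewrite Cmod_mult, Cmod_Ci, !Cmod_R. lra.
  - rewrite <- RtoC_minus. unfold A, B, Ci, Cminus, Cplus, Copp, Cmult, RtoC; simpl. f_equal; ring.
Qed.

Lemma Rder_RtoC (f : R -> R) t l : is_derive f t l -> Rder (fun t => RtoC (f t)) t (RtoC l).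
Proof. intros H. apply (Rder_pair f (fun _ => 0)); auto. apply (is_derive_const (V := R_NormedModule)). Qed.

Lemma is_derive_continuity_pt (f : R -> R) x l : is_derive f x l -> continuity_pt f x.
Proof.
  intros H. apply continuity_pt_filterlim.
  apply (ex_derive_continuous (K := R_AbsRing) (V := R_NormedModule) f x). now exists l.
Qed.

(* The complex mean value inequality reduces to a real one by pairing with the increment. *)
Lemma mean_value_ineq (f : R -> C) (df : R -> C) (p dp : R -> R) a b : a <= b ->
  (forall t, a <= t <= b -> Rder f t (df t)) ->
  (forall t, a <= t <= b -> is_derive p t (dp t)) ->
  (forall t, a <= t <= b -> Cmod (df t) <= dp t) ->
  Cmod (f b - f a) <= p b - p a.
Proof.
  intros Hab Hf Hp Hd.
  set (D := (f b - f a)%C). set (c := Cconj D).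
  destruct (MVT_gen (fun t => Re (c * f t) - Cmod D * p t) a b
     (fun t => Re (c * df t) - Cmod D * dp t)) as [x [Hx E]].
  - intros x Hx. rewrite Rmin_left, Rmax_right in Hx by auto.
    apply (is_derive_minus (K := R_AbsRing) (V := R_NormedModule)
      (fun t => Re (c * f t)) (fun t => Cmod D * p t)).
    + apply Rder_Re. apply der_scal. apply Hf. lra.
    + apply is_derive_scal. apply Hp. lra.
  - intros x Hx. rewrite Rmin_left, Rmax_right in Hx by auto.
    eapply is_derive_continuity_pt. apply (is_derive_minus (K := R_AbsRing) (V := R_NormedModule)
      (fun t => Re (c * f t)) (fun t => Cmod D * p t)).
    + apply Rder_Re. apply der_scal. apply Hf. lra.
    + apply is_derive_scal. apply Hp. lra.
  - rewrite Rmin_left, Rmax_right in Hx by auto.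
    assert (S : Re (c * df x) - Cmod D * dp x <= 0).
    { assert (Hh := Rle_trans _ _ _ (Rle_abs _) (re_le_Cmod (c * df x))).
      rewrite Cmod_mult in Hh. unfold c in Hh at 2. rewrite Cmod_conj in Hh.
      assert (Cmod D * Cmod (df x) <= Cmod D * dp x)
        by (apply Rmult_le_compat_l; [apply Cmod_ge_0|now apply Hd]). lra. }
    assert (S2 : (Re (c * df x) - Cmod D * dp x) * (b - a) <= 0).
    { assert (0 <= - (Re (c * df x) - Cmod D * dp x) * (b - a)) by (apply Rmult_le_pos; lra). lra. }
    assert (S3 : Re (c * f b) - Re (c * f a) = Cmod D ^ 2).
    { rewrite Cmod2_alt. unfold c, D, Cconj, Re, Im, Cmult, Cminus, Cplus, Copp; simpl. ring. }
    (* The pairing yields |D|^2 <= |D| (p b - p a). Cancelling |D| requires D nonzero; for D = 0 it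
       remains to see that p does not decrease, because dp bounds a modulus. *)
    destruct (Req_dec (Cmod D) 0) as [Z|Z].
    + rewrite Z. destruct (MVT_gen p a b dp) as [y [Hy Ey]].
      * intros y Hy. rewrite Rmin_left, Rmax_right in Hy by auto. apply Hp. lra.
      * intros y Hy. rewrite Rmin_left, Rmax_right in Hy by auto.
        eapply is_derive_continuity_pt. apply Hp. lra.
      * rewrite Rmin_left, Rmax_right in Hy by auto. rewrite Ey.
        apply Rmult_le_pos; [|lra]. eapply Rle_trans; [apply Cmod_ge_0|now apply Hd].
    + assert (P : 0 < Cmod D) by (assert (Hh := Cmod_ge_0 D); lra).
      apply Rmult_le_reg_l with (Cmod D); auto.
      replace (Cmod D * Cmod D) with (Cmod D ^ 2) by ring. rewrite <- S3. nra.
Qed.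

Lemma Rder_zero_const (f : R -> C) a b : a <= b ->
  (forall t, a <= t <= b -> Rder f t 0) -> f b = f a.
Proof.
  intros Hab H. apply Cmod_sub_0. apply Rle_antisym; [|apply Cmod_ge_0].
  eapply Rle_trans; [apply (mean_value_ineq f (fun _ => 0%C) (fun _ => 0) (fun _ => 0)); auto|lra].
  - intros. apply (is_derive_const (V := R_NormedModule)).
  - intros. rewrite Cmod_0. lra.
Qed.

(** * Complex-valued integrals *)

Definition Cint (f : R -> C) (a b : R) (I : C) : Prop :=
  is_RInt (V := C_R_NormedModule) f a b I.

Lemma Cint_RInt f a b I : Cint f a b I -> RInt (V := C_R_CompleteNormedModule) f a b = I.
Proof. intros H. apply (is_RInt_unique (V := C_R_CompleteNormedModule)). exact H. Qed.

Lemma Cint_unique f a b I J : Cint f a b I -> Cint f a b J -> I = J.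
Proof. intros H K. rewrite <- (Cint_RInt _ _ _ _ H). now apply Cint_RInt. Qed.

Lemma Cint_exists f a b : a <= b -> (forall t, a <= t <= b -> Rcnt f t) ->
  Cint f a b (RInt (V := C_R_CompleteNormedModule) f a b).
Proof.
  intros Hab H. apply (RInt_correct (V := C_R_CompleteNormedModule)).
  apply (ex_RInt_continuous (V := C_R_CompleteNormedModule)). intros t Ht.
  rewrite Rmin_left, Rmax_right in Ht by auto. apply Rcnt_continuous. now apply H.
Qed.

Lemma Cint_plus f g a b I J : Cint f a b I -> Cint g a b J ->
  Cint (fun t => f t + g t)%C a b (I + J).
Proof. apply (is_RInt_plus (V := C_R_NormedModule)). Qed.

(** [C_R_NormedModule] is a module over the reals, so a complex factor is treated coordinate by
    coordinate through real multiples. *)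
Lemma Cint_scal (c : C) f a b I : Cint f a b I -> Cint (fun t => c * f t)%C a b (c * I).
Proof.
  intros H.
  assert (H1 := is_RInt_fct_extend_fst (U := R_NormedModule) (V := R_NormedModule) f a b I H).
  assert (H2 := is_RInt_fct_extend_snd (U := R_NormedModule) (V := R_NormedModule) f a b I H).
  apply (is_RInt_fct_extend_pair (U := R_NormedModule) (V := R_NormedModule)).
  - apply (is_RInt_minus (V := R_NormedModule)); apply (is_RInt_scal (V := R_NormedModule)); auto.
  - apply (is_RInt_plus (V := R_NormedModule)); apply (is_RInt_scal (V := R_NormedModule)); auto.
Qed.

Lemma Cint_ext f g a b I : a <= b -> (forall t, a <= t <= b -> f t = g t) ->
  Cint f a b I -> Cint g a b I.
Proof.
  intros Hab E. apply (is_RInt_ext (V := C_R_NormedModule)). intros t Ht.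
  rewrite Rmin_left, Rmax_right in Ht by auto. apply E. lra.
Qed.

Lemma Cint_norm f a b I M : a <= b -> (forall t, a <= t <= b -> Cmod (f t) <= M) ->
  Cint f a b I -> Cmod I <= (b - a) * M.
Proof.
  intros Hab H HI. rewrite <- norm_C_R.
  apply (norm_RInt_le_const (V := C_R_NormedModule) f a b I M Hab); auto.
  intros t Ht. rewrite norm_C_R. auto.
Qed.

Lemma Cint_FTC F f a b : a <= b -> (forall t, a <= t <= b -> Rder F t (f t)) ->
  (forall t, a <= t <= b -> Rcnt f t) -> Cint f a b (F b - F a).
Proof.
  intros Hab H K. apply (is_RInt_derive (V := C_R_CompleteNormedModule) F f a b);
    intros t Ht; rewrite Rmin_left, Rmax_right in Ht by auto.
  - apply Rder_is_derive. auto.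
  - apply Rcnt_continuous. auto.
Qed.

(** * Goursat's theorem and primitives on the disc *)

Definition Iseg (f : C -> C) (a b : C) : C :=
  ((b - a) * RInt (V := C_R_CompleteNormedModule) (fun t : R => f (a + t * (b - a))%C) 0 1)%C.

Lemma Cmod_segment (a b : C) r t : Cmod a <= r -> Cmod b <= r -> 0 <= t <= 1 ->
  Cmod (a + t * (b - a)) <= r.
Proof.
  intros Ha Hb Ht.
  replace (a + t * (b - a))%C with (RtoC (1 - t) * a + t * b)%C by (rewrite RtoC_minus; ring).
  eapply Rle_trans; [apply Cmod_triangle|]. rewrite !Cmod_mult, !Cmod_R.
  rewrite (Rabs_pos_eq (1 - t)), (Rabs_pos_eq t) by lra. nra.
Qed.

Lemma inD_segment (a b : C) t : inD a -> inD b -> 0 <= t <= 1 -> inD (a + t * (b - a)).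
Proof.
  unfold inD. intros Ha Hb Ht. eapply Rle_lt_trans.
  - apply (Cmod_segment a b (Rmax (Cmod a) (Cmod b))); auto; [apply Rmax_l|apply Rmax_r].
  - now apply Rmax_lub_lt.
Qed.

Lemma Rder_segment (a d : C) t : Rder (fun t : R => (a + t * d)%C) t d.
Proof.
  eapply der_eq.
  - apply (der_plus RtoC (fun _ => a) (fun t : R => (RtoC t * d)%C)); [apply der_const|].
    apply (der_mult RtoC RtoC (fun _ => d)); [apply der_embed|apply der_const].
  - ring.
Qed.

Lemma Cder_Iseg_FTC F f a b : (forall t, 0 <= t <= 1 ->
    Cder F (a + RtoC t * (b - a))%C (f (a + RtoC t * (b - a))%C) /\ Ccnt f (a + RtoC t * (b - a))%C) ->
  Iseg f a b = (F b - F a)%C.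
Proof.
  intros H. unfold Iseg.
  assert (S : forall t, Rcnt (fun t : R => (a + t * (b - a))%C) t)
    by (intros t; exact (der_cnt _ _ _ _ (Rder_segment a (b - a) t))).
  assert (K : Cint (fun t : R => (b - a) * f (a + t * (b - a)))%C 0 1
      (F (a + 1%R * (b - a)) - F (a + 0%R * (b - a)))%C).
  { apply (Cint_FTC (fun t : R => F (a + t * (b - a)))%C); [lra| |].
    - intros t Ht. rewrite Cmult_comm.
      apply (der_comp RtoC F (fun t : R => a + t * (b - a))%C); [apply Rder_segment|]. now apply H.
    - intros t Ht. apply cnt_mult; [apply cnt_const|].
      apply (cnt_comp RtoC f (fun t : R => a + t * (b - a))%C); [apply S|]. now apply H. }
  replace (a + 1 * (b - a))%C with b in K by ring.
  replace (a + 0 * (b - a))%C with a in K by ring.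
  assert (L := Cint_exists (fun t : R => f (a + t * (b - a))%C) 0 1 Rle_0_1).
  apply (Cint_scal (b - a)) in L.
  - apply (Cint_unique _ _ _ _ _ L K).
  - intros t Ht. apply (cnt_comp RtoC f (fun t : R => a + t * (b - a))%C); [apply S|]. now apply H.
Qed.

Section Segments.
Variable f : C -> C.
Hypothesis Hf : forall z, inD z -> Ccnt f z.

Lemma Rcnt_segment a b t : inD a -> inD b -> 0 <= t <= 1 ->
  Rcnt (fun t : R => f (a + t * (b - a))%C) t.
Proof.
  intros Ha Hb Ht. apply (cnt_comp RtoC f (fun t : R => a + t * (b - a))%C).
  - exact (der_cnt _ _ _ _ (Rder_segment a (b - a) t)).
  - apply Hf. now apply inD_segment.
Qed.

Lemma Iseg_bound a b M : inD a -> inD b ->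
  (forall t, 0 <= t <= 1 -> Cmod (f (a + RtoC t * (b - a))%C) <= M) ->
  Cmod (Iseg f a b) <= M * Cmod (b - a).
Proof.
  intros Ha Hb H. unfold Iseg. rewrite Cmod_mult, Rmult_comm.
  apply Rmult_le_compat_r; [apply Cmod_ge_0|].
  replace M with ((1 - 0) * M) by ring.
  apply (Cint_norm (fun t : R => f (a + t * (b - a))%C)); [lra|exact H|].
  apply Cint_exists; [lra|]. intros; now apply Rcnt_segment.
Qed.

Lemma Iseg_value a b J : Cint (fun t : R => f (a + t * (b - a))%C) 0 1 J ->
  Iseg f a b = ((b - a) * J)%C.
Proof. intros H. unfold Iseg. now rewrite (Cint_RInt _ _ _ _ H). Qed.

Lemma Cint_affine (g : R -> C) u v I : Cint g (u * 0 + v) (u * 1 + v) I ->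
  Cint (fun t => RtoC u * g (u * t + v)%R)%C 0 1 I.
Proof.
  intros H. apply (is_RInt_comp_lin (V := C_R_NormedModule)) in H.
  eapply Cint_ext; [lra| |exact H]. intros t _.
  change ((u * fst (g (u * t + v)%R), u * snd (g (u * t + v)%R))%R = (RtoC u * g (u * t + v)%R)%C).
  unfold RtoC, Cmult; simpl. f_equal; ring.
Qed.

Lemma Iseg_rev a b : inD a -> inD b -> Iseg f b a = (- Iseg f a b)%C.
Proof.
  intros Ha Hb.
  assert (H := Cint_exists (fun t : R => f (a + t * (b - a))%C) 0 1 Rle_0_1
    (fun t Ht => Rcnt_segment a b t Ha Hb Ht)).
  set (I := RInt _ _ _) in H.
  rewrite (Iseg_value a b I H).
  assert (K : Cint (fun t : R => f (a + t * (b - a))%C) (-1 * 0 + 1) (-1 * 1 + 1) (- I)).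
  { replace (-1 * 0 + 1) with 1 by ring. replace (-1 * 1 + 1) with 0 by ring.
    apply (is_RInt_swap (V := C_R_NormedModule)). exact H. }
  apply Cint_affine in K. apply (Cint_scal (RtoC (-1))) in K.
  rewrite (Iseg_value b a (RtoC (-1) * - I)%C); [replace (-1) with (Ropp 1) by ring; rewrite RtoC_opp; ring|].
  eapply Cint_ext; [lra| |exact K]. intros t Ht. cbv beta.
  rewrite Cmult_assoc, <- RtoC_mult. replace (-1 * -1) with 1 by ring. rewrite Cmult_1_l.
  f_equal. replace (-1 * t + 1) with (1 - t) by ring. rewrite RtoC_minus. ring.
Qed.

Definition mid (a b : C) : C := ((a + b) / 2)%C.

Lemma C2_neq_0 : RtoC 2 <> RtoC 0.
Proof. intros H. apply RtoC_inj in H. lra. Qed.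

Lemma mid_sub_l (a b : C) : (mid a b - a)%C = (/ 2 * (b - a))%C.
Proof. unfold mid. field. Qed.

Lemma mid_sub_r (a b : C) : (b - mid a b)%C = (/ 2 * (b - a))%C.
Proof. unfold mid. field. Qed.

Lemma mid_eq (a b : C) : mid a b = (a + / 2 * (b - a))%C.
Proof. unfold mid. field. Qed.

Lemma RtoC_half : RtoC (/ 2) = (/ 2)%C.
Proof. apply RtoC_inv. lra. Qed.

Lemma Cmod_mid (a b : C) r : Cmod a <= r -> Cmod b <= r -> Cmod (mid a b) <= r.
Proof.
  intros Ha Hb. rewrite mid_eq, <- RtoC_half. apply Cmod_segment; auto. lra.
Qed.

Lemma inD_mid a b : inD a -> inD b -> inD (mid a b).
Proof. intros Ha Hb. rewrite mid_eq, <- RtoC_half. apply inD_segment; auto. lra. Qed.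

Lemma Iseg_split a b : inD a -> inD b -> Iseg f a b = (Iseg f a (mid a b) + Iseg f (mid a b) b)%C.
Proof.
  intros Ha Hb. set (g := fun t : R => f (a + t * (b - a))%C).
  assert (H1 : Cint g 0 (/ 2) (RInt (V := C_R_CompleteNormedModule) g 0 (/ 2))).
  { apply Cint_exists; [lra|]. intros; apply Rcnt_segment; auto; lra. }
  assert (H2 : Cint g (/ 2) 1 (RInt (V := C_R_CompleteNormedModule) g (/ 2) 1)).
  { apply Cint_exists; [lra|]. intros; apply Rcnt_segment; auto; lra. }
  set (I := RInt _ _ _) in H1. set (J := RInt _ _ _) in H2.
  assert (H3 : Cint g 0 1 (I + J)) by exact (is_RInt_Chasles (V := C_R_NormedModule) g _ _ _ _ _ H1 H2).
  rewrite (Iseg_value a b _ H3).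
  assert (E1 : / 2 * 0 + 0 = 0) by ring. assert (E2 : / 2 * 1 + 0 = / 2) by ring.
  assert (E3 : / 2 * 0 + / 2 = / 2) by ring. assert (E4 : / 2 * 1 + / 2 = 1) by field.
  assert (A1 := Cint_affine g (/ 2) 0 I). rewrite E1, E2 in A1. apply A1 in H1.
  assert (A2 := Cint_affine g (/ 2) (/ 2) J). rewrite E3, E4 in A2. apply A2 in H2.
  apply (Cint_scal (RtoC 2)) in H1. apply (Cint_scal (RtoC 2)) in H2.
  rewrite (Iseg_value a (mid a b) (2 * I)%C), (Iseg_value (mid a b) b (2 * J)%C).
  - rewrite mid_sub_l, mid_sub_r. field.
  - eapply Cint_ext; [lra| |exact H2]. intros t Ht. cbv beta. unfold g.
    rewrite Cmult_assoc, RtoC_half, Cinv_r, Cmult_1_l by apply C2_neq_0.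
    f_equal. rewrite mid_sub_r, mid_eq, RtoC_plus, RtoC_mult, RtoC_half. ring.
  - eapply Cint_ext; [lra| |exact H1]. intros t Ht. cbv beta. unfold g.
    rewrite Cmult_assoc, RtoC_half, Cinv_r, Cmult_1_l by apply C2_neq_0.
    f_equal. rewrite mid_sub_l, RtoC_plus, RtoC_mult, RtoC_half. ring.
Qed.

Definition Itri (a b c : C) : C := (Iseg f a b + Iseg f b c + Iseg f c a)%C.

(** Each side is cut at its midpoint, and the three sides of the middle triangle are traversed once
    in each direction, so they cancel. *)
Lemma Itri_split a b c : inD a -> inD b -> inD c ->
  Itri a b c = (Itri a (mid a b) (mid c a) + Itri b (mid b c) (mid a b)
                + Itri c (mid c a) (mid b c) + Itri (mid a b) (mid b c) (mid c a))%C.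
Proof.
  intros Ha Hb Hc. unfold Itri.
  rewrite (Iseg_split a b), (Iseg_split b c), (Iseg_split c a) by auto.
  rewrite (Iseg_rev (mid c a) (mid a b)), (Iseg_rev (mid a b) (mid b c)),
    (Iseg_rev (mid b c) (mid c a)) by (apply inD_mid; auto).
  ring.
Qed.

End Segments.

Lemma Iseg_plus f g a b : (forall z, inD z -> Ccnt f z) -> (forall z, inD z -> Ccnt g z) ->
  inD a -> inD b -> Iseg (fun z => f z + g z)%C a b = (Iseg f a b + Iseg g a b)%C.
Proof.
  intros Hf Hg Ha Hb.
  assert (H1 := Cint_exists (fun t : R => f (a + t * (b - a))%C) 0 1 Rle_0_1
    (fun t Ht => Rcnt_segment f Hf a b t Ha Hb Ht)).
  assert (H2 := Cint_exists (fun t : R => g (a + t * (b - a))%C) 0 1 Rle_0_1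
    (fun t Ht => Rcnt_segment g Hg a b t Ha Hb Ht)).
  assert (H3 := Cint_plus _ _ _ _ _ _ H1 H2).
  unfold Iseg. rewrite (Cint_RInt _ _ _ _ H3). ring.
Qed.

(** * Bisection of triangles *)

Definition tri : Type := (C * C * C)%type.
Definition tri_int (f : C -> C) (T : tri) : C := Itri f (fst (fst T)) (snd (fst T)) (snd T).
Definition tri_in (r : R) (T : tri) : Prop :=
  Cmod (fst (fst T)) <= r /\ Cmod (snd (fst T)) <= r /\ Cmod (snd T) <= r.
Definition tri_size (s : R) (T : tri) : Prop :=
  Cmod (snd (fst T) - fst (fst T)) <= s /\ Cmod (snd T - snd (fst T)) <= s /\
  Cmod (fst (fst T) - snd T) <= s.

(** At least one of the four pieces carries a quarter of the integral; if the first three fail, the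
    last one does. The bound on the displacement of the first vertex later makes these vertices
    converge. *)
Lemma tri_refine f r s (T : tri) : r < 1 -> (forall z, inD z -> Ccnt f z) ->
  tri_in r T -> tri_size s T ->
  exists T' : tri, tri_in r T' /\ tri_size (s / 2) T' /\
    Cmod (fst (fst T') - fst (fst T)) <= s /\ Cmod (tri_int f T) <= 4 * Cmod (tri_int f T').
Proof.
  destruct T as [[a b] c]. unfold tri_in, tri_size, tri_int; simpl.
  intros Hr Hf [Ia [Ib Ic]] [Sab [Sbc Sca]].
  assert (Ha : inD a) by (unfold inD; lra). assert (Hb : inD b) by (unfold inD; lra).
  assert (Hc : inD c) by (unfold inD; lra).
  assert (E := Itri_split f Hf a b c Ha Hb Hc).
  set (T1 := Itri f a (mid a b) _) in E. set (T2 := Itri f b _ _) in E.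
  set (T3 := Itri f c _ _) in E. set (T4 := Itri f (mid a b) _ _) in E.
  assert (H4 : Cmod (Itri f a b c) <= Cmod T1 + Cmod T2 + Cmod T3 + Cmod T4).
  { rewrite E. eapply Rle_trans; [apply Cmod_triangle|]. apply Rplus_le_compat_r.
    eapply Rle_trans; [apply Cmod_triangle|]. apply Rplus_le_compat_r. apply Cmod_triangle. }
  assert (Half : forall (x : C) (y : C), y = (/ 2 * x)%C \/ y = (- (/ 2 * x))%C -> Cmod x <= s -> Cmod y <= s / 2).
  { intros x y Hy Hx. assert (Ey : Cmod y = / 2 * Cmod x).
    { destruct Hy as [-> | ->]; rewrite ?Cmod_opp, Cmod_mult, <- RtoC_half, Cmod_R, Rabs_pos_eq; lra. }
    lra. }
  assert (s0 : 0 <= s) by (eapply Rle_trans; [apply Cmod_ge_0|exact Sab]).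
  assert (Half' : forall (x : C), Cmod x <= s -> Cmod (/ 2 * x) <= s).
  { intros x Hx. assert (Hh := Half x (/ 2 * x)%C (or_introl eq_refl) Hx). lra. }
  assert (I1 := Cmod_mid a b r Ia Ib). assert (I2 := Cmod_mid b c r Ib Ic).
  assert (I3 := Cmod_mid c a r Ic Ia).
  destruct (Rle_dec (Cmod (Itri f a b c)) (4 * Cmod T1)) as [K1|K1];
    [|destruct (Rle_dec (Cmod (Itri f a b c)) (4 * Cmod T2)) as [K2|K2];
      [|destruct (Rle_dec (Cmod (Itri f a b c)) (4 * Cmod T3)) as [K3|K3]]].
  - exists (a, mid a b, mid c a); simpl. repeat split; auto.
    + apply (Half (b - a)%C); auto. left. apply mid_sub_l.
    + apply (Half (c - b)%C); auto. left. unfold mid; field.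
    + apply (Half (a - c)%C); auto. left. unfold mid; field.
    + replace (a - a)%C with (RtoC 0) by ring. rewrite Cmod_0. auto.
  - exists (b, mid b c, mid a b); simpl. repeat split; auto.
    + apply (Half (c - b)%C); auto. left. apply mid_sub_l.
    + apply (Half (a - c)%C); auto. left. unfold mid; field.
    + apply (Half (b - a)%C); auto. left. unfold mid; field.
  - exists (c, mid c a, mid b c); simpl. repeat split; auto.
    + apply (Half (a - c)%C); auto. left. apply mid_sub_l.
    + apply (Half (b - a)%C); auto. left. unfold mid; field.
    + apply (Half (c - b)%C); auto. left. unfold mid; field.
    + rewrite Cmod_sub_sym. auto.
  - exists (mid a b, mid b c, mid c a); simpl. repeat split; auto.
    + apply (Half (a - c)%C); auto. right. unfold mid; field.
    + apply (Half (b - a)%C); auto. right. unfold mid; field.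
    + apply (Half (c - b)%C); auto. right. unfold mid; field.
    + rewrite mid_sub_l. auto.
    + fold T4. lra.
Qed.

Section Nested.
Variables (f : C -> C) (r s : R) (T0 : tri).
Hypotheses (Hr : r < 1) (Hf : forall z, inD z -> Ccnt f z)
  (HI : tri_in r T0) (HS : tri_size s T0).

Lemma nested_triangles : exists T : nat -> tri, forall n,
  tri_in r (T n) /\ tri_size (s / 2 ^ n) (T n) /\
  Cmod (fst (fst (T (S n))) - fst (fst (T n))) <= s / 2 ^ n /\
  Cmod (tri_int f T0) <= 4 ^ n * Cmod (tri_int f (T n)).
Proof.
  set (P := fun (s : R) (T T' : tri) => tri_in r T' /\ tri_size (s / 2) T' /\
    Cmod (fst (fst T') - fst (fst T)) <= s /\ Cmod (tri_int f T) <= 4 * Cmod (tri_int f T')).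
  set (next := fun s T => epsilon (inhabits T0) (P s T)).
  set (T := fix T n := match n with O => T0 | S n => next (s / 2 ^ n) (T n) end).
  exists T.
  assert (N : forall n, tri_in r (T n) -> tri_size (s / 2 ^ n) (T n) -> P (s / 2 ^ n) (T n) (T (S n))).
  { intros n A B. simpl. apply epsilon_spec. unfold P. now apply tri_refine. }
  assert (A : forall n, tri_in r (T n) /\ tri_size (s / 2 ^ n) (T n) /\
    Cmod (tri_int f T0) <= 4 ^ n * Cmod (tri_int f (T n))).
  { induction n as [|n [A [B D]]].
    - simpl. replace (s / 1) with s by field. split; [auto|]. split; [auto|]. lra.
    - destruct (N n A B) as [A' [B' [_ D']]]. split; [auto|]. split.
      + replace (s / 2 ^ S n) with (s / 2 ^ n / 2); [exact B'|]. simpl. field. apply pow_nonzero. lra.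
      + simpl pow. eapply Rle_trans; [exact D|].
        replace (4 * 4 ^ n * Cmod (tri_int f (T (S n))))
          with (4 ^ n * (4 * Cmod (tri_int f (T (S n))))) by ring.
        apply Rmult_le_compat_l; [apply pow_le; lra|exact D']. }
  intros n. destruct (A n) as [A1 [A2 A3]]. repeat split; try apply A1; try apply A2; auto.
  now destruct (N n A1 A2) as [_ [_ [D' _]]].
Qed.

End Nested.

Lemma halving_small s d : 0 < d -> exists n, s / 2 ^ n < d.
Proof.
  intros Hd0. assert (G := is_lim_seq_geom (/ 2)). rewrite Rabs_pos_eq in G by lra.
  specialize (G ltac:(lra)).
  assert (G2 := is_lim_seq_scal_l _ s _ G). simpl in G2.
  apply is_lim_seq_spec in G2. rewrite Rmult_0_r in G2.
  destruct (G2 (mkposreal _ Hd0)) as [N HN]. exists N.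
  specialize (HN N (le_n _)). simpl in HN. rewrite Rminus_0_r, pow_inv in HN.
  eapply Rle_lt_trans; [apply Rle_abs|]. exact HN.
Qed.

Lemma real_halving_limit (u : nat -> R) s : (forall n, Rabs (u (S n) - u n) <= s / 2 ^ n) ->
  exists l, forall n, Rabs (u n - l) <= 2 * s / 2 ^ n.
Proof.
  intros H.
  assert (s0 : 0 <= s).
  { specialize (H O). simpl in H. assert (Hh := Rabs_pos (u 1%nat - u O)). lra. }
  assert (P2 : forall n, 0 < / 2 ^ n) by (intros; apply Rinv_0_lt_compat, pow_lt; lra).
  (* The geometric tail is subtracted so that the induction on [m] closes: the next increment uses
     up exactly s / 2^(n+m). *)
  assert (D : forall n m, Rabs (u (n + m)%nat - u n) <= 2 * s / 2 ^ n - 2 * s / 2 ^ (n + m)).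
  { intros n m. induction m as [|m IH].
    - rewrite Nat.add_0_r. unfold Rminus at 1. rewrite Rplus_opp_r, Rabs_R0. lra.
    - rewrite Nat.add_succ_r.
      replace (u (S (n + m)) - u n) with ((u (S (n + m)) - u (n + m)%nat) + (u (n + m)%nat - u n)) by ring.
      eapply Rle_trans; [apply Rabs_triang|]. specialize (H (n + m)%nat).
      replace (2 * s / 2 ^ S (n + m)) with (s / 2 ^ (n + m)).
      + replace (2 * s / 2 ^ (n + m)) with (2 * (s / 2 ^ (n + m))) in IH by (field; apply pow_nonzero; lra).
        lra.
      + simpl. field. apply pow_nonzero. lra. }
  assert (B : forall n m, (n <= m)%nat -> Rabs (u m - u n) <= 2 * s / 2 ^ n).
  { intros n m Hnm. replace m with (n + (m - n))%nat by lia. eapply Rle_trans; [apply D|].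
    assert (0 <= 2 * s / 2 ^ (n + (m - n))) by (apply Rmult_le_pos; [lra|left; apply P2]). lra. }
  assert (HC : ex_lim_seq_cauchy u).
  { intros e. assert (L : exists N, 2 * s / 2 ^ N < e / 2).
    { apply halving_small. destruct e; simpl; lra. }
    destruct L as [N HN]. exists N. intros n m Hn Hm.
    replace (u n - u m) with ((u n - u N) - (u m - u N)) by ring.
    eapply Rle_lt_trans; [apply Rabs_triang|]. rewrite Rabs_Ropp.
    assert (B1 := B N n Hn). assert (B2 := B N m Hm). lra. }
  apply ex_lim_seq_cauchy_corr in HC. destruct HC as [l Hl]. exists l. intros n.
  rewrite Rabs_minus_sym.
  apply (is_lim_seq_le (fun m => Rabs (u (m + n)%nat - u n)) (fun _ => 2 * s / 2 ^ n) (Rabs (l - u n)) (2 * s / 2 ^ n)).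
  - intros m. apply B. lia.
  - apply (is_lim_seq_abs (fun m => u (m + n)%nat - u n) (l - u n)).
    apply is_lim_seq_minus'; [|apply is_lim_seq_const]. now apply (is_lim_seq_incr_n u n l).
  - apply is_lim_seq_const.
Qed.

Lemma complex_halving_limit (u : nat -> C) s : (forall n, Cmod (u (S n) - u n) <= s / 2 ^ n) ->
  exists l, forall n, Cmod (u n - l) <= 4 * s / 2 ^ n.
Proof.
  intros H.
  destruct (real_halving_limit (fun n => Re (u n)) s) as [x Hx].
  { intros n. eapply Rle_trans; [|apply (H n)]. exact (re_le_Cmod (u (S n) - u n)). }
  destruct (real_halving_limit (fun n => Im (u n)) s) as [y Hy].
  { intros n. eapply Rle_trans; [|apply (H n)]. exact (im_le_Cmod (u (S n) - u n)). }
  exists (x, y). intros n. specialize (Hx n). specialize (Hy n).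
  replace (u n - (x, y))%C with (RtoC (Re (u n) - x) + Ci * RtoC (Im (u n) - y))%C.
  - eapply Rle_trans; [apply Cmod_triangle|]. rewrite Cmod_mult, Cmod_Ci, !Cmod_R.
    replace (4 * s / 2 ^ n) with (2 * s / 2 ^ n + 2 * s / 2 ^ n) by (field; apply pow_nonzero; lra).
    lra.
  - unfold Ci, RtoC, Cmult, Cminus, Cplus, Copp, Re, Im; simpl. destruct (u n); simpl. f_equal; ring.
Qed.

(** The affine part f p + l (z - p) has the explicit quadratic primitive [P], so it integrates to 0
    around a closed triangle. *)
Lemma Itri_affine_deviation f p l a b c : (forall z, inD z -> Ccnt f z) ->
  inD a -> inD b -> inD c ->
  Itri f a b c = Itri (fun z => f z - f p - l * (z - p))%C a b c.
Proof.
  intros Hf Ha Hb Hc.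
  set (A := fun z => (f p + l * (z - p))%C).
  set (B := fun z => (f z - f p - l * (z - p))%C).
  set (P := fun z => (f p * z + l * / 2 * ((z - p) * (z - p)))%C).
  assert (CA : forall z, Ccnt A z).
  { intros z. apply cnt_plus; [apply cnt_const|]. apply cnt_mult; [apply cnt_const|].
    apply cnt_minus; [apply cnt_embed|apply cnt_const]. }
  assert (CB : forall z, inD z -> Ccnt B z).
  { intros z Hz. apply cnt_minus; [apply cnt_minus; [now apply Hf|apply cnt_const]|].
    apply cnt_mult; [apply cnt_const|]. apply cnt_minus; [apply cnt_embed|apply cnt_const]. }
  assert (DP : forall z, Cder P z (A z)).
  { intros z. assert (Dz : Cder (fun z => z - p)%C z (1 - 0)).
    { apply der_minus; [apply der_embed|apply der_const]. }
    eapply der_eq.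
    - apply der_plus; [apply der_scal; apply der_embed|]. apply der_scal.
      apply (der_mult _ (fun z => z - p)%C (fun z => z - p)%C); exact Dz.
    - unfold A. field. }
  assert (IA : forall x y, Iseg A x y = (P y - P x)%C).
  { intros x y. apply Cder_Iseg_FTC. intros; split; auto. }
  assert (S : forall x y, inD x -> inD y -> Iseg f x y = (Iseg A x y + Iseg B x y)%C).
  { intros x y Hx Hy. rewrite <- Iseg_plus by auto.
    replace (fun z => A z + B z)%C with f; auto.
    apply functional_extensionality. intros z. unfold A, B. ring. }
  unfold Itri. fold B. rewrite !S, !IA by auto. ring.
Qed.

Theorem goursat f a b c : (forall z, inD z -> exists l, Cder f z l) ->
  inD a -> inD b -> inD c -> Itri f a b c = 0%C.
Proof.
  intros Hd Ha Hb Hc.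
  assert (Hf : forall z, inD z -> Ccnt f z).
  { intros z Hz. destruct (Hd z Hz) as [l Hl]. exact (der_cnt _ _ _ _ Hl). }
  (* A closed disc of radius r < 1 contains every triangle of the sequence, which keeps the limit
     point inside the open disc. *)
  set (r := Rmax (Cmod a) (Rmax (Cmod b) (Cmod c))).
  assert (Hr : r < 1) by (unfold r; repeat apply Rmax_lub_lt; auto).
  assert (Ra : Cmod a <= r) by apply Rmax_l.
  assert (Rb : Cmod b <= r) by (eapply Rle_trans; [apply Rmax_l|apply Rmax_r]).
  assert (Rc : Cmod c <= r) by (eapply Rle_trans; [apply Rmax_r|apply Rmax_r]).
  (* The added 1 keeps [s] positive for degenerate triangles. *)
  set (s := Cmod (b - a) + Cmod (c - b) + Cmod (a - c) + 1).
  assert (P1 := Cmod_ge_0 (b - a)). assert (P2 := Cmod_ge_0 (c - b)). assert (P3 := Cmod_ge_0 (a - c)).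
  assert (s0 : 0 < s) by (unfold s; lra).
  destruct (nested_triangles f r s (a, b, c) Hr Hf) as [T HT].
  { repeat split; auto. }
  { repeat split; simpl; unfold s; lra. }
  destruct (complex_halving_limit (fun n => fst (fst (T n))) s) as [p Hp].
  { intros n. apply HT. }
  assert (Q : forall n, 0 < s / 2 ^ n) by (intros; apply Rdiv_lt_0_compat; auto; apply pow_lt; lra).
  assert (HL : forall d, 0 < d -> exists n, s / 2 ^ n < d).
  { apply halving_small. }
  assert (Dp : inD p).
  { unfold inD. apply Rle_lt_trans with r; auto. apply Rnot_lt_le. intros Hlt.
    destruct (HL ((Cmod p - r) / 4)) as [n Hn]; [lra|].
    specialize (Hp n). destruct (HT n) as [[I1 _] _].
    assert (Hh := Cmod_le_sub p (fst (fst (T n)))). rewrite Cmod_sub_sym in Hh.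
    replace (4 * s / 2 ^ n) with (4 * (s / 2 ^ n)) in Hp by (field; apply pow_nonzero; lra). lra. }
  destruct (Hd p Dp) as [l Hl].
  apply Cmod_eq_0. apply Rle_antisym; [|apply Cmod_ge_0]. apply Rnot_lt_le. intros Hpos.
  set (X := Cmod (Itri f a b c)) in *.
  (* Each of the three sides contributes at most 5 e sn^2 with sn = s / 2^n. After multiplication by
     4^n the total is 15 e s^2 = X / 2, which contradicts X > 0. *)
  set (e := X / (30 * (s * s))).
  assert (ss : 0 < s * s) by (apply Rmult_lt_0_compat; auto).
  assert (He : 0 < e) by (apply Rdiv_lt_0_compat; lra).
  destruct (Hl e He) as [d [Hd0 H1]].
  (* The first vertex is within 4 sn of [p] and the others within 5 sn, hence the whole triangle
     too; sn < d / 6 puts all of it inside the radius [d]. *)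
  destruct (HL (d / 6)) as [n Hn]; [lra|].
  destruct (HT n) as [[I1 [I2 I3]] [[S1 [S2 S3]] [_ B]]]. specialize (Hp n).
  unfold tri_int in B. simpl (Itri f (fst (fst (a, b, c))) _ _) in B. fold X in B.
  destruct (T n) as [[x y] z]. simpl in *.
  assert (Dx : inD x) by (unfold inD; lra). assert (Dy : inD y) by (unfold inD; lra).
  assert (Dz : inD z) by (unfold inD; lra).
  set (sn := s / 2 ^ n) in *. specialize (Q n). fold sn in Q.
  replace (4 * s / 2 ^ n) with (4 * sn) in Hp by (unfold sn; field; apply pow_nonzero; lra).
  rewrite (Itri_affine_deviation f p l) in B by auto.
  set (g := fun z => (f z - f p - l * (z - p))%C) in *.
  assert (Cg : forall z, inD z -> Ccnt g z).
  { intros w Hw. apply cnt_minus; [apply cnt_minus; [now apply Hf|apply cnt_const]|].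
    apply cnt_mult; [apply cnt_const|]. apply cnt_minus; [apply cnt_embed|apply cnt_const]. }
  assert (Seg : forall u v, inD u -> inD v -> Cmod (u - p) <= 5 * sn -> Cmod (v - p) <= 5 * sn ->
    Cmod (v - u) <= sn -> Cmod (Iseg g u v) <= 5 * e * sn * sn).
  { intros u v Hu Hv Du Dv Huv. eapply Rle_trans; [apply (Iseg_bound g Cg u v (e * (5 * sn))); auto|].
    - intros t Ht. assert (K : Cmod (u + t * (v - u) - p) <= 5 * sn).
      { replace (u + t * (v - u) - p)%C with ((u - p) + t * ((v - p) - (u - p)))%C by ring.
        now apply Cmod_segment. }
      unfold g. eapply Rle_trans; [apply H1; lra|]. apply Rmult_le_compat_l; lra.
    - replace (5 * e * sn * sn) with (e * (5 * sn) * sn) by ring.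
      apply Rmult_le_compat_l; auto. apply Rmult_le_pos; lra. }
  assert (Yp := Cmod_sub_triangle y x p). assert (Zp := Cmod_sub_triangle z x p).
  rewrite (Cmod_sub_sym z x) in Zp.
  assert (J1 : Cmod (Iseg g x y) <= 5 * e * sn * sn) by (apply Seg; auto; lra).
  assert (J2 : Cmod (Iseg g y z) <= 5 * e * sn * sn) by (apply Seg; auto; lra).
  assert (J3 : Cmod (Iseg g z x) <= 5 * e * sn * sn) by (apply Seg; auto; lra).
  assert (J : Cmod (Itri g x y z) <= 15 * e * (sn * sn)).
  { unfold Itri. eapply Rle_trans; [apply Cmod_triangle|].
    eapply Rle_trans; [apply Rplus_le_compat_r, Cmod_triangle|]. lra. }
  assert (F : 4 ^ n * (15 * e * (sn * sn)) = X / 2).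
  { unfold e, sn. replace 4 with (2 * 2) by ring. rewrite Rpow_mult_distr. field.
    split; [apply pow_nonzero; lra|lra]. }
  assert (4 ^ n * Cmod (Itri g x y z) <= 4 ^ n * (15 * e * (sn * sn)))
    by (apply Rmult_le_compat_l; [apply pow_le; lra|auto]).
  lra.
Qed.

Lemma Iseg_refl f a : Iseg f a a = 0%C.
Proof. unfold Iseg. ring. Qed.

Lemma Iseg_const (c a b : C) : Iseg (fun _ => c) a b = (c * (b - a))%C.
Proof.
  rewrite (Cder_Iseg_FTC (fun z => c * z)%C (fun _ => c)); [ring|].
  intros t _. split; [|apply cnt_const]. eapply der_eq; [apply der_scal, der_embed|ring].
Qed.

(** Goursat on the triangle 0, z, w turns the increment of the integral into the integral over
    [z, w], where f differs from f(z) by at most e. *)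
Theorem primitive_on_disc f : (forall z, inD z -> exists l, Cder f z l) ->
  forall z, inD z -> Cder (Iseg f 0) z (f z).
Proof.
  intros Hd z Hz e He.
  assert (Hf : forall z, inD z -> Ccnt f z).
  { intros w Hw. destruct (Hd w Hw) as [l Hl]. exact (der_cnt _ _ _ _ Hl). }
  assert (D0 : inD 0) by (unfold inD; rewrite Cmod_0; lra).
  destruct (Hf z Hz e He) as [d [Hd0 H1]].
  exists (Rmin d (1 - Cmod z)). unfold inD in Hz. split; [apply Rmin_glb_lt; lra|]. intros w Hw.
  assert (Hw1 := Rlt_le_trans _ _ _ Hw (Rmin_l _ _)).
  assert (Hw2 := Rlt_le_trans _ _ _ Hw (Rmin_r _ _)).
  assert (Dw : inD w) by (assert (Hh := Cmod_le_sub w z); unfold inD; lra).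
  assert (G := goursat f 0 z w Hd D0 Hz Dw). unfold Itri in G.
  rewrite (Iseg_rev f Hf 0 w) in G by auto.
  replace (Iseg f 0 w - Iseg f 0 z)%C with (Iseg f z w).
  2:{ replace (Iseg f z w) with (Iseg f 0 z + Iseg f z w + - Iseg f 0 w
        + (Iseg f 0 w - Iseg f 0 z))%C by ring. rewrite G. ring. }
  set (g := fun w => (f w + - f z)%C).
  assert (Cg : forall z, inD z -> Ccnt g z) by (intros u Hu; apply cnt_plus; [now apply Hf|apply cnt_const]).
  replace (Iseg f z w - f z * (w - z))%C with (Iseg g z w).
  - apply Iseg_bound; auto. intros t Ht. left. apply (H1 (z + t * (w - z))%C).
    replace (z + t * (w - z) - z)%C with (t * (w - z))%C by ring.
    rewrite Cmod_mult, Cmod_R, Rabs_pos_eq by lra.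
    assert (Hh := Cmod_ge_0 (w - z)). nra.
  - unfold g. rewrite (Iseg_plus f (fun _ => - f z)%C), Iseg_const by (auto; intros; apply cnt_const). ring.
Qed.

(** * Complex exponential, logarithm and powers *)

Definition cexp (z : C) : C := (exp (Re z) * cos (Im z), exp (Re z) * sin (Im z)).

Lemma cexp_plus z w : cexp (z + w) = (cexp z * cexp w)%C.
Proof.
  unfold cexp, Cmult, Cplus, Re, Im; simpl. rewrite exp_plus, cos_plus, sin_plus. f_equal; ring.
Qed.

Lemma cexp_0 : cexp 0 = 1%C.
Proof. unfold cexp, RtoC, Re, Im; simpl. rewrite exp_0, cos_0, sin_0. f_equal; ring. Qed.

Lemma Cmod_cexp z : Cmod (cexp z) = exp (Re z).
Proof.
  unfold Cmod, cexp; simpl.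
  replace (exp (Re z) * cos (Im z) * (exp (Re z) * cos (Im z) * 1) +
     exp (Re z) * sin (Im z) * (exp (Re z) * sin (Im z) * 1))
    with (Rsqr (exp (Re z)) * (Rsqr (sin (Im z)) + Rsqr (cos (Im z)))) by (unfold Rsqr; ring).
  rewrite sin2_cos2, Rmult_1_r. apply sqrt_Rsqr. left. apply exp_pos.
Qed.

Lemma cexp_neq_0 z : cexp z <> 0%C.
Proof. apply Cmod_gt_0. rewrite Cmod_cexp. apply exp_pos. Qed.

Lemma cexp_opp z : cexp (- z) = (/ cexp z)%C.
Proof.
  assert (H : (cexp (- z) * cexp z)%C = 1%C).
  { rewrite <- cexp_plus. replace (- z + z)%C with (RtoC 0) by ring. apply cexp_0. }
  rewrite <- (Cmult_1_l (/ cexp z)), <- H, <- Cmult_assoc, Cinv_r by apply cexp_neq_0. ring.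
Qed.

(** On a ray only the real functions exp, cos and sin have to be differentiated. Complex
    differentiability of [cexp] follows from these ray derivatives by applying the mean value
    inequality twice. *)
Lemma Rder_cexp_ray h t : Rder (fun t : R => cexp (t * h)) t (h * cexp (t * h)).
Proof.
  destruct h as [x y].
  assert (E : (fun t : R => cexp (t * (x, y))) =
    (fun t : R => (exp (t * x) * cos (t * y), exp (t * x) * sin (t * y)))).
  { apply functional_extensionality. intros s. unfold cexp, Cmult, RtoC, Re, Im; simpl.
    replace (s * x - 0 * y) with (s * x) by ring. replace (s * y + 0 * x) with (s * y) by ring. reflexivity. }
  rewrite E. eapply der_eq.
  - apply Rder_pair; auto_derive; auto.
  - unfold cexp, Cmult, RtoC, Re, Im; simpl.
    replace (t * x - 0 * y) with (t * x) by ring. replace (t * y + 0 * x) with (t * y) by ring.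
    f_equal; ring.
Qed.

Lemma cexp_sub_1_bound h : Cmod h <= 1 -> Cmod (cexp h - 1) <= exp 1 * Cmod h.
Proof.
  intros Hh.
  assert (M := mean_value_ineq (fun t : R => cexp (t * h)) (fun t : R => h * cexp (t * h))%C
    (fun t => exp 1 * Cmod h * t) (fun _ => exp 1 * Cmod h) 0 1 Rle_0_1).
  cbv beta in M. replace (1 * h)%C with h in M by ring. replace (0 * h)%C with (RtoC 0) in M by ring.
  rewrite cexp_0, Rmult_1_r, Rmult_0_r, Rminus_0_r in M. apply M.
  - intros. apply Rder_cexp_ray.
  - intros. auto_derive; auto; ring.
  - intros t Ht. rewrite Cmod_mult, Cmod_cexp, Rmult_comm.
    apply Rmult_le_compat_r; [apply Cmod_ge_0|].
    assert (K : Re (t * h) <= 1).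
    { eapply Rle_trans; [apply Rle_abs|]. eapply Rle_trans; [apply re_le_Cmod|].
      rewrite Cmod_mult, Cmod_R, Rabs_pos_eq by lra. assert (Q := Cmod_ge_0 h). nra. }
    destruct K as [K|K]; [left; now apply exp_increasing|rewrite K; lra].
Qed.

(** This quadratic remainder is the derivative of [cexp] at 0; the addition formula transports it to
    every point. *)
Lemma cexp_sub_1_sub_bound h : Cmod h <= 1 -> Cmod (cexp h - 1 - h) <= exp 1 * Cmod h * Cmod h.
Proof.
  intros Hh.
  assert (M := mean_value_ineq (fun t : R => cexp (t * h) - t * h)%C (fun t : R => h * cexp (t * h) - h)%C
    (fun t => exp 1 * Cmod h * Cmod h * t) (fun _ => exp 1 * Cmod h * Cmod h) 0 1 Rle_0_1).
  cbv beta in M. replace (1 * h)%C with h in M by ring. replace (0 * h)%C with (RtoC 0) in M by ring.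
  rewrite cexp_0, Rmult_1_r, Rmult_0_r, Rminus_0_r in M.
  replace (cexp h - 1 - h)%C with (cexp h - h - (1 - 0))%C by ring. apply M.
  - intros. apply der_minus; [apply Rder_cexp_ray|].
    eapply der_eq; [apply (der_mult RtoC RtoC (fun _ => h)); [apply der_embed|apply der_const]|]. ring.
  - intros. auto_derive; auto; ring.
  - intros t Ht. replace (h * cexp (t * h) - h)%C with (h * (cexp (t * h) - 1))%C by ring.
    rewrite Cmod_mult, Rmult_comm. apply Rmult_le_compat_r; [apply Cmod_ge_0|].
    assert (Q := Cmod_ge_0 h).
    assert (K : Cmod (t * h) <= Cmod h) by (rewrite Cmod_mult, Cmod_R, Rabs_pos_eq by lra; nra).
    eapply Rle_trans; [apply cexp_sub_1_bound; lra|]. apply Rmult_le_compat_l; auto. left; apply exp_pos.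
Qed.

Lemma Cder_cexp z : Cder cexp z (cexp z).
Proof.
  intros e He. assert (Pz := exp_pos (Re z)). assert (P1 := exp_pos 1).
  set (K := exp (Re z) * exp 1). assert (HK : 0 < K) by (apply Rmult_lt_0_compat; auto).
  exists (Rmin 1 (e / K)). split; [apply Rmin_glb_lt; [lra|now apply Rdiv_lt_0_compat]|].
  intros w Hw. assert (H1 := Rlt_le_trans _ _ _ Hw (Rmin_l _ _)).
  assert (H2 := Rlt_le_trans _ _ _ Hw (Rmin_r _ _)).
  replace (cexp w) with (cexp z * cexp (w - z))%C
    by (rewrite <- cexp_plus; f_equal; ring).
  replace (cexp z * cexp (w - z) - cexp z - cexp z * (w - z))%C
    with (cexp z * (cexp (w - z) - 1 - (w - z)))%C by ring.
  rewrite Cmod_mult, Cmod_cexp.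
  assert (B := cexp_sub_1_sub_bound (w - z) (Rlt_le _ _ H1)).
  apply Rle_trans with (exp (Re z) * (exp 1 * Cmod (w - z) * Cmod (w - z))).
  - apply Rmult_le_compat_l; lra.
  - replace (exp (Re z) * (exp 1 * Cmod (w - z) * Cmod (w - z)))
      with (K * Cmod (w - z) * Cmod (w - z)) by (unfold K; ring).
    apply Rmult_le_compat_r; [apply Cmod_ge_0|].
    replace e with (K * (e / K)) by (field; lra). apply Rmult_le_compat_l; lra.
Qed.

(** The principal argument of 1 - z: on the disc Re (1 - z) > 0, so the arctangent of the slope
    suffices, with values in (-PI/2, PI/2). *)
Definition angle1m (z : C) : R := atan (- Im z / (1 - Re z)).
Definition Log1m (z : C) : C := (ln (Cmod (1 - z)), angle1m z).

Lemma inD_Re z : inD z -> Re z < 1.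
Proof.
  unfold inD. intros H. eapply Rle_lt_trans; [|exact H].
  eapply Rle_trans; [apply Rle_abs|apply re_le_Cmod].
Qed.

Lemma inD_one_minus_neq_0 z : inD z -> (1 - z)%C <> 0%C.
Proof.
  intros H E. apply inD_Re in H.
  assert (K : Re (1 - z) = 0) by (rewrite E; reflexivity).
  unfold Re, Cminus, Cplus, Copp, RtoC in K; simpl in K. unfold Re in H. lra.
Qed.

Lemma inD_scale z t : inD z -> 0 <= t <= 1 -> inD (t * z).
Proof.
  unfold inD. intros H Ht. rewrite Cmod_mult, Cmod_R, Rabs_pos_eq by lra.
  assert (Q := Cmod_ge_0 z). nra.
Qed.

Lemma inD_0 : inD 0.
Proof. unfold inD. rewrite Cmod_0. lra. Qed.

Lemma cexp_Log1m z : inD z -> cexp (Log1m z) = (1 - z)%C.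
Proof.
  intros H. assert (HN := inD_one_minus_neq_0 z H). assert (Hx := inD_Re z H).
  change ((exp (ln (Cmod (1 - z))) * cos (angle1m z), exp (ln (Cmod (1 - z))) * sin (angle1m z))
    = (1 - z)%C).
  rewrite exp_ln by now apply Cmod_gt_0.
  unfold angle1m. rewrite cos_atan, sin_atan.
  destruct z as [x y]. unfold Re, Im in *; simpl in *.
  set (u := - y / (1 - x)).
  assert (E : Cmod (1 - (x, y)) = (1 - x) * sqrt (1 + u²)).
  { unfold Cmod; simpl.
    replace ((1 + - x) * ((1 + - x) * 1) + (0 + - y) * ((0 + - y) * 1)) with ((1 - x)² * (1 + u²))
      by (unfold u, Rsqr; field; lra).
    rewrite sqrt_mult_alt by apply Rle_0_sqr. rewrite sqrt_Rsqr by lra. reflexivity. }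
  rewrite E. assert (S : sqrt (1 + u²) <> 0).
  { apply Rgt_not_eq. apply sqrt_lt_R0. assert (Hh := Rle_0_sqr u). lra. }
  unfold Cminus, Cplus, Copp, RtoC; simpl. f_equal.
  - field. exact S.
  - replace ((1 - x) * sqrt (1 + u²) * (u / sqrt (1 + u²))) with ((1 - x) * u) by (field; exact S).
    unfold u. field. lra.
Qed.

Lemma Rder_Log1m_ray z t : inD z -> 0 <= t <= 1 ->
  Rder (fun t : R => Log1m (t * z)) t (z * (- / (1 - t * z))).
Proof.
  intros H Ht. assert (D := inD_scale z t H Ht). assert (Hx := inD_Re _ D).
  destruct z as [x y].
  assert (E : (fun t : R => Log1m (t * (x, y))) = (fun t : R =>
     (ln (sqrt ((1 - t * x) ^ 2 + (t * y) ^ 2)), atan (- (t * y) / (1 - t * x))))).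
  { apply functional_extensionality. intros s.
    unfold Log1m, angle1m, Cmod, Cminus, Copp, Cplus, Cmult, RtoC, Re, Im; simpl.
    f_equal; [f_equal; f_equal; ring|]. f_equal. f_equal; ring. }
  assert (Hx' : 0 < 1 - t * x).
  { unfold Re, Cmult, RtoC in Hx; simpl in Hx. lra. }
  assert (N : 0 < (1 - t * x) ^ 2 + (t * y) ^ 2) by nra.
  assert (N2 : 0 < (1 - t * x) * ((1 - t * x) * 1) + t * y * (t * y * 1)) by nra.
  rewrite E. eapply der_eq.
  - apply Rder_pair.
    + auto_derive; [|reflexivity]. split; [exact N2|]. split; [now apply sqrt_lt_R0|auto].
    + auto_derive; [lra|reflexivity].
  - unfold Cmult, Copp, Cinv, Cminus, Cplus, Copp, RtoC; simpl.
    set (q := (1 + - (t * x)) * ((1 + - (t * x)) * 1) + t * y * (t * y * 1)).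
    replace ((1 + - (t * x - 0 * y)) * ((1 + - (t * x - 0 * y)) * 1) +
      (0 + - (t * y + 0 * x)) * ((0 + - (t * y + 0 * x)) * 1)) with q by (unfold q; ring).
    assert (Q : 0 < q) by (unfold q; nra).
    f_equal.
    + clearbody q. replace (/ sqrt q) with (sqrt q * / q).
      2:{ rewrite <- (sqrt_sqrt q) at 2 by lra. field. apply Rgt_not_eq, sqrt_lt_R0, Q. }
      field. split; [lra|]. apply Rgt_not_eq, sqrt_lt_R0, Q.
    + unfold q in *. field. repeat split; nra.
Qed.

Lemma Cder_one_minus z : Cder (fun z => 1 - z)%C z (- (1)).
Proof. eapply der_eq; [apply der_minus; [apply der_const|apply der_embed]|ring]. Qed.

Lemma Cder_inv_one_minus z : inD z -> Cder (fun z => / (1 - z))%C z (/ ((1 - z) * (1 - z))).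
Proof.
  intros H. assert (N := inD_one_minus_neq_0 z H). eapply der_eq.
  - apply (der_inv _ (fun z => 1 - z)%C); [exact N|]. apply Cder_one_minus.
  - field. exact N.
Qed.

Lemma inD_near z : inD z -> exists d, 0 < d /\ forall w, Cmod (w - z) < d -> inD w.
Proof.
  unfold inD. intros H. exists (1 - Cmod z). split; [lra|]. intros w Hw.
  assert (K := Cmod_le_sub w z). lra.
Qed.

Lemma Cder_ext_D f g z l : inD z -> eqD f g -> Cder f z l -> Cder g z l.
Proof.
  intros Hz E. destruct (inD_near z Hz) as [d [Hd H]].
  apply der_near_ext with d; auto.
Qed.

Lemma Log1m_0 : Log1m 0 = 0%C.
Proof.
  unfold Log1m, angle1m. replace (1 - 0)%C with (RtoC 1) by ring. rewrite Cmod_1, ln_1.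
  unfold RtoC, Re, Im; simpl. replace (- 0 / (1 - 0)) with 0 by field. now rewrite atan_0.
Qed.

(** Only the derivative along rays is computed by hand. It identifies [Log1m] with the primitive of
    - 1 / (1 - z) from Goursat's theorem, which is complex differentiable. *)
Lemma Cder_Log1m z : inD z -> Cder Log1m z (- / (1 - z)).
Proof.
  intros Hz. set (f := fun z => (- / (1 - z))%C).
  assert (Hf : forall z, inD z -> exists l, Cder f z l).
  { intros w Hw. eexists. apply der_opp. now apply Cder_inv_one_minus. }
  apply (Cder_ext_D (Iseg f 0)); auto; [|exact (primitive_on_disc f Hf z Hz)].
  intros w Hw. unfold Iseg.
  assert (Hc : forall t, 0 <= t <= 1 -> Rcnt (fun t : R => f (t * w)%C) t).
  { intros t Ht. apply (cnt_comp RtoC f (fun t : R => t * w)%C).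
    - apply cnt_mult; [apply cnt_embed|apply cnt_const].
    - destruct (Hf (t * w)%C (inD_scale w t Hw Ht)) as [l Hl]. exact (der_cnt _ _ _ _ Hl). }
  assert (K : Cint (fun t : R => w * f (t * w))%C 0 1 (Log1m (1 * w) - Log1m (0 * w))%C).
  { apply (Cint_FTC (fun t : R => Log1m (t * w))); [lra| |].
    - intros t Ht. now apply Rder_Log1m_ray.
    - intros t Ht. apply cnt_mult; [apply cnt_const|now apply Hc]. }
  replace (1 * w)%C with w in K by ring. replace (0 * w)%C with (RtoC 0) in K by ring.
  rewrite Log1m_0 in K.
  replace (fun t : R => f (0 + t * (w - 0))%C) with (fun t : R => f (t * w)%C).
  2:{ apply functional_extensionality. intros t. f_equal. ring. }
  assert (L := Cint_scal w _ _ _ _ (Cint_exists _ 0 1 Rle_0_1 Hc)).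
  assert (EQ := Cint_unique _ _ _ _ _ L K).
  replace (w - 0)%C with w by ring. rewrite EQ. ring.
Qed.

(** The power (1 - z)^c, in the branch with value 1 at z = 0. *)
Definition Pow (c z : C) : C := cexp (c * Log1m z).

Lemma Pow_plus c d z : Pow (c + d) z = (Pow c z * Pow d z)%C.
Proof. unfold Pow. rewrite <- cexp_plus. f_equal. ring. Qed.

Lemma Pow_0_r c : Pow c 0 = 1%C.
Proof. unfold Pow. rewrite Log1m_0, Cmult_0_r. apply cexp_0. Qed.

Lemma Pow_0_l z : Pow 0 z = 1%C.
Proof. unfold Pow. rewrite Cmult_0_l. apply cexp_0. Qed.

Lemma Pow_1_l z : inD z -> Pow 1 z = (1 - z)%C.
Proof. intros H. unfold Pow. rewrite Cmult_1_l. now apply cexp_Log1m. Qed.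

Lemma Pow_neq_0 c z : Pow c z <> 0%C.
Proof. apply cexp_neq_0. Qed.

Lemma Pow_nat n z : inD z -> Pow (INR n) z = ((1 - z) ^ n)%C.
Proof.
  intros H. induction n as [|n IH].
  - apply Pow_0_l.
  - rewrite S_INR, RtoC_plus, Pow_plus, IH, Pow_1_l by auto. simpl. ring.
Qed.

Lemma Cder_Pow c z : inD z -> Cder (Pow c) z (- c / (1 - z) * Pow c z).
Proof.
  intros H. eapply der_eq.
  - apply (der_comp _ cexp (fun z => c * Log1m z)%C); [apply der_scal; now apply Cder_Log1m|apply Cder_cexp].
  - unfold Pow. field. now apply inD_one_minus_neq_0.
Qed.

Lemma Cmod_Pow c z : Cmod (Pow c z) = exp (Re c * ln (Cmod (1 - z)) - Im c * angle1m z).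
Proof. unfold Pow. rewrite Cmod_cexp. reflexivity. Qed.

Lemma Cmod_Pow_real c t : 0 <= t < 1 -> Cmod (Pow c t) = exp (Re c * ln (1 - t)).
Proof.
  intros Ht. rewrite Cmod_Pow, <- RtoC_minus, Cmod_R, Rabs_pos_eq by lra.
  unfold angle1m. replace (- Im t / (1 - Re t)) with 0.
  - rewrite atan_0. f_equal. ring.
  - unfold Re, Im, RtoC; simpl. field. lra.
Qed.

Lemma exp_le x y : x <= y -> exp x <= exp y.
Proof. intros [H| ->]; [left; now apply exp_increasing|lra]. Qed.

Lemma ln_le x y : 0 < x -> x <= y -> ln x <= ln y.
Proof. intros H [K| ->]; [left; now apply ln_increasing|lra]. Qed.

Lemma Cmod_one_minus_ge z : 1 - Cmod z <= Cmod (1 - z).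
Proof. assert (H := Cmod_le_sub 1 z). rewrite Cmod_1 in H. lra. Qed.

(** This is 2^(Re c) e^(PI |Im c|): the 2 bounds the quotient of |1 - z| by |1 - t z|, and PI bounds
    the difference of two arguments in (-PI/2, PI/2). *)
Definition Pow_const (c : C) : R := exp (Re c * ln 2 + Rabs (Im c) * PI).

(* |1 - z| <= 2 |1 - t z| because |1 - z| <= |1 - t z| + (1 - t) and |1 - t z| >= 1 - t. *)
Lemma Cmod_Pow_quotient c z t : 0 <= Re c -> inD z -> 0 <= t <= 1 ->
  Cmod (Pow c z * Pow (- c) (t * z)) <= Pow_const c.
Proof.
  intros Hc Hz Ht. assert (Dt := inD_scale z t Hz Ht).
  rewrite Cmod_mult, !Cmod_Pow, <- exp_plus. apply exp_le.
  assert (N1 := proj1 (Cmod_gt_0 _) (inD_one_minus_neq_0 _ Hz)).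
  assert (N2 := proj1 (Cmod_gt_0 _) (inD_one_minus_neq_0 _ Dt)).
  assert (B : Cmod (1 - z) <= 2 * Cmod (1 - t * z)).
  { assert (T := Cmod_sub_triangle 1 (t * z) z).
    replace (t * z - z)%C with (- (RtoC (1 - t) * z))%C in T by (rewrite RtoC_minus; ring).
    rewrite Cmod_opp, Cmod_mult, Cmod_R, Rabs_pos_eq in T by lra.
    assert (G := Cmod_one_minus_ge (t * z)). rewrite Cmod_mult, Cmod_R, Rabs_pos_eq in G by lra.
    unfold inD in Hz. assert (Q := Cmod_ge_0 z). nra. }
  assert (L : ln (Cmod (1 - z)) - ln (Cmod (1 - t * z)) <= ln 2).
  { assert (K := ln_le _ _ N1 B). rewrite ln_mult in K by lra. lra. }
  assert (A : Rabs (angle1m (t * z) - angle1m z) <= PI).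
  { unfold angle1m. set (p := - Im z / _). set (q := - Im _ / _).
    assert (Bp := atan_bound p). assert (Bq := atan_bound q). apply Rabs_le. lra. }
  replace (Re (- c)) with (- Re c) by reflexivity. replace (Im (- c)) with (- Im c) by reflexivity.
  apply Rle_trans with (Re c * (ln (Cmod (1 - z)) - ln (Cmod (1 - t * z))) + Im c * (angle1m (t * z) - angle1m z)).
  { right. ring. }
  apply Rplus_le_compat; [now apply Rmult_le_compat_l|].
  eapply Rle_trans; [apply Rle_abs|]. rewrite Rabs_mult.
  apply Rmult_le_compat_l; auto. apply Rabs_pos.
Qed.

Lemma Cmod_Pow_bound c z : 0 <= Re c -> inD z -> Cmod (Pow c z) <= Pow_const c.
Proof.
  intros Hc Hz. assert (H := Cmod_Pow_quotient c z 0 Hc Hz ltac:(lra)).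
  replace (0 * z)%C with (RtoC 0) in H by ring. now rewrite Pow_0_r, Cmult_1_r in H.
Qed.

(** The power t^b with default value 0 for t <= 0. For Re b >= 0 it is bounded by 1 for t <= 1, so a
    product with a factor vanishing at 0 is continuous there even when t^b itself has no limit. *)
Definition tpow (b : C) (t : R) : C := if Rlt_dec 0 t then cexp (b * ln t) else 0%C.

Lemma tpow_pos b t : 0 < t -> tpow b t = cexp (b * ln t).
Proof. unfold tpow. destruct (Rlt_dec 0 t); tauto. Qed.

Lemma tpow_npos b t : t <= 0 -> tpow b t = 0%C.
Proof. unfold tpow. destruct (Rlt_dec 0 t); [lra|auto]. Qed.

Lemma tpow_1 b : tpow b 1 = 1%C.
Proof. rewrite tpow_pos by lra. rewrite ln_1, Cmult_0_r. apply cexp_0. Qed.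

Lemma Cmod_tpow b t : 0 < t -> Cmod (tpow b t) = exp (Re b * ln t).
Proof.
  intros H. rewrite tpow_pos by auto. rewrite Cmod_cexp. f_equal.
  unfold Re, Cmult, RtoC; simpl. ring.
Qed.

Lemma Cmod_tpow_le b t : 0 <= Re b -> t <= 1 -> Cmod (tpow b t) <= 1.
Proof.
  intros Hb Ht. destruct (Rlt_dec 0 t) as [H|H].
  - rewrite Cmod_tpow by auto. rewrite <- exp_0. apply exp_le.
    assert (K := ln_le t 1 H Ht). rewrite ln_1 in K. nra.
  - rewrite tpow_npos by lra. rewrite Cmod_0. lra.
Qed.

Lemma tpow_plus_1 b t : 0 < t -> tpow (1 + b) t = (t * tpow b t)%C.
Proof.
  intros H. rewrite !tpow_pos by auto.
  replace ((1 + b) * ln t)%C with (ln t + b * ln t)%C by ring. rewrite cexp_plus. f_equal.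
  unfold cexp, Re, Im, RtoC; simpl. rewrite exp_ln, cos_0, sin_0 by auto. f_equal; ring.
Qed.

Lemma Rder_tpow b t : 0 < t -> Rder (tpow b) t (b / t * tpow b t).
Proof.
  intros H. rewrite tpow_pos by auto.
  apply (der_near_ext RtoC (fun t => cexp (b * ln t)) _ t _ t); auto.
  - intros s Hs. rewrite RtoC_sub_mod in Hs. apply Rabs_lt_between in Hs. rewrite tpow_pos; auto. lra.
  - eapply der_eq.
    + apply (der_comp RtoC cexp (fun t => b * ln t)%C); [|apply Cder_cexp].
      apply der_scal. apply Rder_RtoC. apply is_derive_Reals. now apply derivable_pt_lim_ln.
    + rewrite RtoC_inv by lra. field. intros E. apply RtoC_inj in E. lra.
Qed.

Lemma polar_form z : exists th : R, z = (Cmod z * cexp (th * Ci))%C.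
Proof.
  assert (E : forall th : R, cexp (th * Ci) = (cos th, sin th)).
  { intros th. unfold cexp, Ci, Cmult, RtoC, Re, Im; simpl.
    replace (th * 0 - 0 * 1) with 0 by ring. replace (th * 1 + 0 * 0) with th by ring.
    rewrite exp_0. f_equal; ring. }
  destruct (Ceq_dec z 0) as [Z|Z].
  { exists 0. rewrite Z, Cmod_0. ring. }
  assert (P := proj1 (Cmod_gt_0 _) Z). set (r := Cmod z) in *.
  assert (S : Re z ^ 2 + Im z ^ 2 = r ^ 2) by (symmetry; apply Cmod2_alt).
  assert (B : -1 <= Re z / r <= 1).
  { assert (Hh := re_le_Cmod z). fold r in Hh. apply Rabs_le_between in Hh.
    split; [apply Rmult_le_reg_r with r|apply Rmult_le_reg_r with r]; auto;
      unfold Rdiv; rewrite Rmult_assoc, Rinv_l by lra; lra. }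
  assert (S1 : sin (acos (Re z / r)) = Rabs (Im z) / r).
  { rewrite sin_acos by auto.
    replace (1 - (Re z / r)²) with ((Im z / r)²).
    - rewrite sqrt_Rsqr_abs. unfold Rdiv. rewrite Rabs_mult, (Rabs_pos_eq (/ r)); auto.
      left. now apply Rinv_0_lt_compat.
    - unfold Rsqr. replace (1 - Re z / r * (Re z / r)) with ((r ^ 2 - Re z ^ 2) / (r ^ 2)) by (field; lra).
      replace (r ^ 2 - Re z ^ 2) with (Im z ^ 2) by lra. field. lra. }
  destruct (Rle_dec 0 (Im z)) as [Hy|Hy].
  - exists (acos (Re z / r)). rewrite E, S1, cos_acos, Rabs_pos_eq by auto.
    destruct z as [x y]. unfold Cmult, RtoC, Re, Im; simpl. f_equal; field; lra.
  - exists (- acos (Re z / r)). rewrite E, cos_neg, sin_neg, S1, cos_acos, Rabs_left by (auto; lra).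
    destruct z as [x y]. unfold Cmult, RtoC, Re, Im; simpl. f_equal; field; lra.
Qed.

(** * The Euler equation z U' + (1 + b) U = G *)

Definition holo (f : C -> C) : Prop := forall z, inD z -> exists l, Cder f z l.

Lemma holo_cnt f : holo f -> forall z, inD z -> Ccnt f z.
Proof. intros H z Hz. destruct (H z Hz) as [l Hl]. exact (der_cnt _ _ _ _ Hl). Qed.

Lemma Rder_ray (z : C) t : Rder (fun t : R => t * z)%C t z.
Proof.
  eapply der_eq; [apply (der_mult RtoC RtoC (fun _ => z)); [apply der_embed|apply der_const]|]. ring.
Qed.

Lemma Rcnt_ray f (z : C) (t : R) : Ccnt f (t * z)%C -> Rcnt (fun t : R => f (t * z)%C) t.
Proof.
  intros H. apply (cnt_comp RtoC f (fun t : R => t * z)%C); auto.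
  exact (der_cnt _ _ _ _ (Rder_ray z t)).
Qed.

Lemma Rder_comp_ray f (z : C) (t : R) l : Cder f (t * z)%C l ->
  Rder (fun t : R => f (t * z)%C) t (z * l).
Proof.
  intros H. rewrite Cmult_comm. apply (der_comp RtoC f (fun t : R => t * z)%C); auto. apply Rder_ray.
Qed.

(** Compactness of the segment [0, z] gives one radius for all its points, while [w] ranges over
    full complex neighbourhoods of it. *)
Lemma ray_uniform_continuity g z e : (forall z, inD z -> Ccnt g z) -> inD z -> 0 < e ->
  exists d, 0 < d /\ forall t, 0 <= t <= 1 -> forall w, Cmod (w - t * z) < d ->
    inD w /\ Cmod (g w - g (t * z)%C) < e.
Proof.
  intros Hg Hz He.
  assert (L : forall t, exists d : posreal, 0 <= t <= 1 ->
    forall w, Cmod (w - t * z) < 2 * d -> inD w /\ Cmod (g w - g (t * z)%C) < e / 2).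
  { intros t. destruct (excluded_middle_informative (0 <= t <= 1)) as [Ht|Ht].
    - assert (Dt := inD_scale z t Hz Ht).
      destruct (inD_near _ Dt) as [d1 [Hd1 H1]].
      destruct (Hg _ Dt (e / 2)) as [d2 [Hd2 H2]]; [lra|].
      assert (P : 0 < Rmin d1 d2 / 2) by (assert (0 < Rmin d1 d2) by (now apply Rmin_glb_lt); lra).
      exists (mkposreal _ P). intros _ w Hw. simpl in Hw.
      assert (Hw' : Cmod (w - t * z) < Rmin d1 d2) by lra. split.
      + apply H1. eapply Rlt_le_trans; [exact Hw'|apply Rmin_l].
      + apply H2. eapply Rlt_le_trans; [exact Hw'|apply Rmin_r].
    - exists (mkposreal 1 Rlt_0_1). tauto. }
  set (delta := fun t => proj1_sig (constructive_indefinite_description _ (L t))).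
  assert (Hdelta : forall t, 0 <= t <= 1 -> forall w, Cmod (w - t * z) < 2 * delta t ->
    inD w /\ Cmod (g w - g (t * z)%C) < e / 2).
  { intros t. exact (proj2_sig (constructive_indefinite_description _ (L t))). }
  (* The nearby centre [t] is only obtained under a double negation, so the goal is negated first.
     The radii were taken as 2 [delta] so that both [w] and x z lie in the neighbourhood of t z. *)
  destruct (compactness_value_1d 0 1 delta) as [d Hd].
  exists d. split; [apply cond_pos|]. intros x Hx w Hw.
  apply NNPP. intros Neg. apply (Hd x Hx). intros [t [Ht [Hxt Hdt]]]. apply Neg. clear Neg.
  assert (X : Cmod (x * z - t * z) < delta t).
  { replace (x * z - t * z)%C with (RtoC (x - t) * z)%C by (rewrite RtoC_minus; ring).
    rewrite Cmod_mult, Cmod_R. unfold inD in Hz.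
    assert (A := Rabs_pos (x - t)). assert (B := Cmod_ge_0 z). nra. }
  assert (T := Cmod_sub_triangle w (x * z) (t * z)).
  assert (Dp := cond_pos (delta t)).
  destruct (Hdelta t Ht w) as [A B]; [lra|].
  destruct (Hdelta t Ht (x * z)%C) as [_ B']; [lra|].
  split; auto. assert (T2 := Cmod_sub_triangle (g w) (g (t * z)%C) (g (x * z)%C)).
  rewrite (Cmod_sub_sym (g (t * z)%C)) in T2. lra.
Qed.

Section Euler.
Variables (b : C) (G : C -> C).
Hypotheses (Hb : 0 <= Re b) (HG : holo G) (G0 : G 0 = 0%C).

Let P := Iseg G 0.

Lemma euler_primitive_der z : inD z -> Cder P z (G z).
Proof. apply primitive_on_disc. exact HG. Qed.

Lemma euler_primitive_0 : P 0 = 0%C.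
Proof. apply Iseg_refl. Qed.

(** Since G(0) = 0, the primitive is o(t) along the ray, which makes t^(b-1) P(t z) continuous at t
    = 0 even for Re b = 0. *)
Lemma euler_primitive_small z e : inD z -> 0 < e -> exists d, 0 < d /\ forall t, Rabs t < d ->
  Cmod (P (t * z)%C) <= e * Rabs t.
Proof.
  intros Hz He. destruct (euler_primitive_der 0 inD_0 e He) as [d [Hd H]]. exists d. split; auto. intros t Ht.
  unfold inD in Hz. assert (A := Rabs_pos t). assert (B := Cmod_ge_0 z).
  assert (K : Cmod (t * z - 0) <= Rabs t).
  { replace (t * z - 0)%C with (t * z)%C by ring. rewrite Cmod_mult, Cmod_R. nra. }
  specialize (H (t * z)%C (Rle_lt_trans _ _ _ K Ht)). rewrite euler_primitive_0, G0 in H.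
  replace (P (t * z) - 0 - 0 * (t * z - 0))%C with (P (t * z)%C) in H by ring.
  eapply Rle_trans; [exact H|]. apply Rmult_le_compat_l; lra.
Qed.

(** The candidate solution U is the integral of t^b G(t z). Differentiating it directly would bring
    in G', whose continuity is unknown. The integral W of t^(b-1) P(t z) only needs P' = G: it
    satisfies W' = U, and integration by parts gives z U = P - b W. Differentiating this identity
    yields both the derivative of U and the equation. *)
Let kU (z : C) (t : R) : C := (tpow b t * G (t * z))%C.
Let kW (z : C) (t : R) : C := (tpow b t * / t * P (t * z))%C.
Let U (z : C) : C := RInt (V := C_R_CompleteNormedModule) (kU z) 0 1.
Let W (z : C) : C := RInt (V := C_R_CompleteNormedModule) (kW z) 0 1.

Lemma Rcnt_tpow t : 0 < t -> Rcnt (tpow b) t.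
Proof. intros H. exact (der_cnt _ _ _ _ (Rder_tpow b t H)). Qed.

Lemma euler_kernel_cnt z t : inD z -> 0 <= t <= 1 -> Rcnt (kU z) t.
Proof.
  intros Hz Ht. assert (Cg := Rcnt_ray G z t (holo_cnt G HG _ (inD_scale z t Hz Ht))).
  destruct (Rlt_dec 0 t) as [Hp|Hp].
  - apply cnt_mult; auto. now apply Rcnt_tpow.
  - assert (t = 0) by lra. subst t. intros e He. destruct (Cg e He) as [d [Hd H]].
    exists (Rmin d 1). split; [apply Rmin_glb_lt; lra|]. intros s Hs.
    assert (H1 := Rlt_le_trans _ _ _ Hs (Rmin_l _ _)). assert (H2 := Rlt_le_trans _ _ _ Hs (Rmin_r _ _)).
    specialize (H s H1). replace (0 * z)%C with (RtoC 0) in H by ring. rewrite G0 in H.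
    replace (G (s * z)%C - 0)%C with (G (s * z)%C) in H by ring.
    unfold kU. rewrite (tpow_npos b 0) by lra.
    replace (tpow b s * G (s * z) - 0 * G (0 * z))%C with (tpow b s * G (s * z))%C by ring.
    rewrite RtoC_sub_mod, Rminus_0_r in H2. apply Rabs_lt_between in H2.
    rewrite Cmod_mult. eapply Rle_lt_trans; [|exact H].
    assert (A := Cmod_tpow_le b s Hb ltac:(lra)). assert (B := Cmod_ge_0 (G (s * z)%C)). nra.
Qed.

Lemma euler_parts_kernel_bound z s e : s <= 1 -> 0 <= e -> Cmod (P (s * z)%C) <= e * Rabs s -> Cmod (kW z s) <= e.
Proof.
  intros Hs He H. unfold kW. destruct (Rlt_dec 0 s) as [Hp|Hp].
  - rewrite !Cmod_mult, <- RtoC_inv, Cmod_R, Rabs_pos_eq by (try left; try apply Rinv_0_lt_compat; lra).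
    rewrite Rabs_pos_eq in H by lra. assert (A := Cmod_tpow_le b s Hb Hs).
    assert (B := Cmod_ge_0 (tpow b s)).
    apply Rle_trans with (1 * / s * (e * s)).
    + apply Rmult_le_compat; auto using Cmod_ge_0.
      * apply Rmult_le_pos; auto. left. now apply Rinv_0_lt_compat.
      * apply Rmult_le_compat_r; auto. left. now apply Rinv_0_lt_compat.
    + right. field. lra.
  - rewrite tpow_npos by lra. rewrite !Cmult_0_l, Cmod_0. auto.
Qed.

Lemma euler_parts_kernel_cnt z t : inD z -> 0 <= t <= 1 -> Rcnt (kW z) t.
Proof.
  intros Hz Ht. destruct (Rlt_dec 0 t) as [Hp|Hp].
  - apply cnt_mult; [apply cnt_mult|].
    + now apply Rcnt_tpow.
    + apply (cnt_inv RtoC RtoC); [|apply cnt_embed]. intros E. apply RtoC_inj in E. lra.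
    + apply Rcnt_ray. exact (der_cnt _ _ _ _ (euler_primitive_der _ (inD_scale z t Hz Ht))).
  - assert (t = 0) by lra. subst t. intros e He.
    destruct (euler_primitive_small z (e / 2) Hz) as [d [Hd H]]; [lra|].
    exists (Rmin d 1). split; [apply Rmin_glb_lt; lra|]. intros s Hs.
    rewrite RtoC_sub_mod, Rminus_0_r in Hs.
    assert (H1 := Rlt_le_trans _ _ _ Hs (Rmin_l _ _)). assert (H2 := Rlt_le_trans _ _ _ Hs (Rmin_r _ _)).
    apply Rabs_lt_between in H2.
    replace (kW z 0) with (RtoC 0) by (unfold kW; rewrite tpow_npos by lra; ring).
    replace (kW z s - 0)%C with (kW z s) by ring.
    apply Rle_lt_trans with (e / 2); [|lra]. apply euler_parts_kernel_bound; try lra. now apply H.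
Qed.

Lemma euler_integral z : inD z -> Cint (kU z) 0 1 (U z).
Proof. intros Hz. apply Cint_exists; [lra|]. intros; now apply euler_kernel_cnt. Qed.

Lemma euler_parts_integral z : inD z -> Cint (kW z) 0 1 (W z).
Proof. intros Hz. apply Cint_exists; [lra|]. intros; now apply euler_parts_kernel_cnt. Qed.

Lemma euler_by_parts z : inD z -> (b * W z + z * U z)%C = P z.
Proof.
  intros Hz.
  set (F := fun t : R => (tpow b t * P (t * z))%C).
  assert (K : Cint (fun t => b * kW z t + z * kU z t)%C 0 1 (F 1 - F 0)%C).
  { apply (Cint_FTC F); [lra| |].
    - intros t Ht. destruct (Rlt_dec 0 t) as [Hp|Hp].
      + eapply der_eq.
        * apply der_mult; [now apply Rder_tpow|]. apply Rder_comp_ray. apply euler_primitive_der. now apply inD_scale.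
        * unfold kW, kU. field. intros E. apply RtoC_inj in E. lra.
      (* At the endpoint the default values make the claimed derivative 0, and t^b P(t z) is indeed
         o(t). *)
      + assert (t = 0) by lra. subst t. intros e He.
        destruct (euler_primitive_small z e Hz He) as [d [Hd H]].
        exists (Rmin d 1). split; [apply Rmin_glb_lt; lra|]. intros s Hs.
        rewrite RtoC_sub_mod, Rminus_0_r in Hs |- *.
        assert (H1 := Rlt_le_trans _ _ _ Hs (Rmin_l _ _)). assert (H2 := Rlt_le_trans _ _ _ Hs (Rmin_r _ _)).
        apply Rabs_lt_between in H2.
        unfold F, kW, kU. rewrite (tpow_npos b 0) by lra.
        replace (tpow b s * P (s * z) - 0 * P (0 * z) - (b * (0 * / 0 * P (0 * z)) +
          z * (0 * G (0 * z))) * (s - 0))%C with (tpow b s * P (s * z))%C by ring.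
        rewrite Cmod_mult. eapply Rle_trans; [|now apply H].
        assert (A := Cmod_tpow_le b s Hb ltac:(lra)). assert (B := Cmod_ge_0 (P (s * z)%C)). nra.
    - intros t Ht. apply cnt_plus; apply cnt_mult; try apply cnt_const; [now apply euler_parts_kernel_cnt|now apply euler_kernel_cnt]. }
  assert (L := Cint_plus _ _ _ _ _ _ (Cint_scal b _ _ _ _ (euler_parts_integral z Hz)) (Cint_scal z _ _ _ _ (euler_integral z Hz))).
  rewrite (Cint_unique _ _ _ _ _ L K). unfold F. rewrite tpow_1, tpow_npos by lra.
  replace (1 * z)%C with z by ring. ring.
Qed.

Lemma euler_parts_der z : inD z -> Cder W z (U z).
Proof.
  intros Hz e He.
  destruct (ray_uniform_continuity G z e (holo_cnt G HG) Hz He) as [d [Hd H]].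
  exists d. split; auto. intros w Hw.
  assert (Seg : forall t u, 0 <= t <= 1 -> 0 <= u <= 1 ->
    Cmod (t * z + u * (t * (w - z)) - t * z) < d).
  { intros t u Ht Hu. replace (t * z + u * (t * (w - z)) - t * z)%C with (u * (t * (w - z)))%C by ring.
    rewrite !Cmod_mult, !Cmod_R, !Rabs_pos_eq by lra. assert (Q := Cmod_ge_0 (w - z)).
    apply Rle_lt_trans with (Cmod (w - z)); auto. assert (0 <= t * Cmod (w - z) <= Cmod (w - z)) by nra. nra. }
  assert (Dw : inD w).
  { destruct (H 1 ltac:(lra) w) as [A _]; auto. replace (1 * z)%C with z by ring. auto. }
  (* The remainder must be small relative to t, not just to |w - z|: this factor t cancels the 1 / t
     in [kW]. *)
  assert (MV : forall t, 0 <= t <= 1 ->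
    Cmod (P (t * w)%C - P (t * z)%C - t * (w - z) * G (t * z)%C) <= e * Cmod (w - z) * t).
  { intros t Ht. set (h := (t * (w - z))%C).
    assert (Eh : Cmod h = t * Cmod (w - z)) by (unfold h; rewrite Cmod_mult, Cmod_R, Rabs_pos_eq; lra).
    assert (M := mean_value_ineq (fun u : R => P (t * z + u * h) - u * (h * G (t * z)))%C
      (fun u : R => h * (G (t * z + u * h) - G (t * z)))%C
      (fun u => e * Cmod h * u) (fun _ => e * Cmod h) 0 1 Rle_0_1).
    cbv beta in M.
    replace (P (t * w)%C - P (t * z)%C - h * G (t * z)%C)%C with
      (P (t * z + 1%R * h) - 1%R * (h * G (t * z)) - (P (t * z + 0%R * h) - 0%R * (h * G (t * z))))%C.
    - eapply Rle_trans; [apply M|].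
      + intros u Hu. eapply der_eq.
        * apply der_minus.
          { apply (der_comp RtoC P (fun u : R => t * z + u * h)%C); [apply Rder_segment|].
            apply euler_primitive_der. apply (H t Ht). now apply Seg. }
          { apply Rder_ray. }
        * ring.
      + intros u Hu. auto_derive; auto; ring.
      + intros u Hu. rewrite Cmod_mult, Rmult_comm. apply Rmult_le_compat_r; [apply Cmod_ge_0|].
        left. apply (H t Ht). now apply Seg.
      + rewrite Eh. right. ring.
    - replace (t * z + 1 * h)%C with (t * w)%C by (unfold h; ring).
      replace (t * z + 0 * h)%C with (t * z)%C by ring. unfold h. ring. }
  assert (L := Cint_plus _ _ _ _ _ _ (Cint_plus _ _ _ _ _ _ (euler_parts_integral w Dw) (Cint_scal (- (1)) _ _ _ _ (euler_parts_integral z Hz)))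
    (Cint_scal (- (w - z)) _ _ _ _ (euler_integral z Hz))).
  replace (W w - W z - U z * (w - z))%C with (W w + - (1) * W z + - (w - z) * U z)%C by ring.
  replace (e * Cmod (w - z)) with ((1 - 0) * (e * Cmod (w - z))) by ring.
  eapply Cint_norm; [| |exact L]; [lra|]. intros t Ht. cbv beta.
  assert (Q := Cmod_ge_0 (w - z)).
  unfold kW, kU. destruct (Rlt_dec 0 t) as [Hp|Hp].
  - assert (Nt : RtoC t <> 0%C) by (intros E; apply RtoC_inj in E; lra).
    replace (tpow b t * / t * P (t * w) + - (1) * (tpow b t * / t * P (t * z)) +
       - (w - z) * (tpow b t * G (t * z)))%C
      with (tpow b t * (/ t * (P (t * w)%C - P (t * z)%C - t * (w - z) * G (t * z)%C)))%C by (field; auto).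
    rewrite !Cmod_mult, <- RtoC_inv, Cmod_R, Rabs_pos_eq by (try left; try apply Rinv_0_lt_compat; lra).
    assert (A := Cmod_tpow_le b t Hb ltac:(lra)). assert (B := Cmod_ge_0 (tpow b t)).
    specialize (MV t Ht). set (X := Cmod (P _ - _ - _)) in *.
    assert (Y : / t * X <= e * Cmod (w - z)).
    { apply Rmult_le_reg_l with t; auto. rewrite <- Rmult_assoc, Rinv_r by lra. lra. }
    assert (0 <= / t * X).
    { apply Rmult_le_pos; [left; now apply Rinv_0_lt_compat|apply Cmod_ge_0]. }
    nra.
  - rewrite tpow_npos by lra. rewrite !Cmult_0_l, !Cmult_0_r, !Cplus_0_l, Cmod_0. nra.
Qed.

Lemma euler_integral_der z : inD z -> exists l, Cder U z l /\ (z * l + (1 + b) * U z)%C = G z.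
Proof.
  intros Hz. destruct (Ceq_dec z 0) as [Z|Z].
  (* The formula (P - b W) / z says nothing at 0. There U is expanded directly: its derivative is
     G'(0) times the integral of t^(1+b). *)
  - subst z.
    assert (U0 : U 0 = 0%C).
    { apply (Cint_unique (kU 0) 0 1 (U 0) 0); [now apply euler_integral|].
      apply (Cint_ext (fun _ => 0%C)); [lra| |].
      - intros t _. unfold kU. rewrite Cmult_0_r, G0. ring.
      - assert (Z := Cint_FTC (fun _ => 0%C) (fun _ => 0%C) 0 1 Rle_0_1
          (fun t _ => der_const RtoC 0 t) (fun t _ => cnt_const RtoC 0 t)).
        cbv beta in Z. replace (0 - 0)%C with (RtoC 0) in Z by ring. exact Z. }
    destruct (HG 0 Hz) as [l Hl].
    assert (TC : forall t, 0 <= t <= 1 -> Rcnt (fun t => tpow b t * t)%C t).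
    { intros t Ht. destruct (Rlt_dec 0 t) as [Hp|Hp].
      - apply cnt_mult; [now apply Rcnt_tpow|apply cnt_embed].
      - assert (t = 0) by lra. subst t. intros e He. exists (Rmin e 1).
        split; [apply Rmin_glb_lt; lra|]. intros s Hs. rewrite RtoC_sub_mod, Rminus_0_r in Hs.
        assert (H1 := Rlt_le_trans _ _ _ Hs (Rmin_l _ _)). assert (H2 := Rlt_le_trans _ _ _ Hs (Rmin_r _ _)).
        apply Rabs_lt_between in H2.
        replace (tpow b s * s - tpow b 0 * 0)%C with (tpow b s * s)%C by ring.
        rewrite Cmod_mult, Cmod_R. assert (A := Cmod_tpow_le b s Hb ltac:(lra)).
        assert (B := Rabs_pos s). nra. }
    assert (CI := Cint_exists _ 0 1 Rle_0_1 TC). set (c := RInt _ _ _) in CI.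
    exists (c * l)%C. split; [|rewrite U0, G0; ring].
    intros e He. destruct (Hl e He) as [d [Hd H]].
    exists (Rmin d 1). split; [apply Rmin_glb_lt; lra|]. intros w Hw.
    assert (H1 := Rlt_le_trans _ _ _ Hw (Rmin_l _ _)). assert (H2 := Rlt_le_trans _ _ _ Hw (Rmin_r _ _)).
    assert (Dw : inD w) by (unfold inD; replace w with (w - 0)%C by ring; auto).
    rewrite U0.
    assert (L := Cint_plus _ _ _ _ _ _ (euler_integral w Dw) (Cint_scal (- (l * w)) _ _ _ _ CI)).
    replace (U w - 0 - c * l * (w - 0))%C with (U w + - (l * w) * c)%C by ring.
    replace (e * Cmod (w - 0)) with ((1 - 0) * (e * Cmod (w - 0))) by ring.
    eapply Cint_norm; [| |exact L]; [lra|]. intros t Ht. cbv beta. unfold kU.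
    replace (tpow b t * G (t * w) + - (l * w) * (tpow b t * t))%C
      with (tpow b t * (G (t * w) - G 0 - l * (t * w - 0)))%C by (rewrite G0; ring).
    replace (w - 0)%C with w in H1 |- * by ring.
    assert (Q := Cmod_ge_0 w).
    assert (E : Cmod (t * w - 0) = t * Cmod w).
    { replace (t * w - 0)%C with (t * w)%C by ring. rewrite Cmod_mult, Cmod_R, Rabs_pos_eq; lra. }
    assert (B : Cmod (G (t * w) - G 0 - l * (t * w - 0)) <= e * (t * Cmod w)).
    { rewrite <- E. apply H. rewrite E. nra. }
    rewrite Cmod_mult. assert (A := Cmod_tpow_le b t Hb ltac:(lra)).
    assert (A' := Cmod_ge_0 (tpow b t)). set (X := Cmod (G _ - _ - _)) in *.
    assert (0 <= X) by apply Cmod_ge_0. assert (t * Cmod w <= Cmod w) by nra.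
    assert (e * (t * Cmod w) <= e * Cmod w) by (apply Rmult_le_compat_l; lra). nra.
  (* Away from 0, U coincides near z with (P - b W) / z, a quotient of functions already
     differentiated. *)
  - assert (HV : Cder (fun z => (P z - b * W z) * / z)%C z
      ((G z - b * U z) * / z + (P z - b * W z) * (- (1) / (z * z)))%C).
    { apply (der_mult (fun z : C => z) (fun z => P z - b * W z)%C Cinv z).
      - apply (der_minus (fun z : C => z) P (fun z => b * W z)%C); [now apply euler_primitive_der|].
        apply der_scal. now apply euler_parts_der.
      - apply (der_inv (fun z : C => z) (fun z : C => z)); [exact Z|]. apply der_embed. }
    eexists. split.
    + destruct (Ccnt_neq_0 (fun z : C => z) (fun z => z) z (cnt_embed _ z) Z) as [d1 [Hd1 N1]].
      destruct (inD_near z Hz) as [d2 [Hd2 N2]].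
      apply (der_near_ext (fun z : C => z) _ U z _ (Rmin d1 d2)) in HV; [exact HV|now apply Rmin_glb_lt|].
      intros y Hy. assert (Ny := N1 y (Rlt_le_trans _ _ _ Hy (Rmin_l _ _))).
      assert (Dy := N2 y (Rlt_le_trans _ _ _ Hy (Rmin_r _ _))). cbv beta in Ny.
      rewrite <- (euler_by_parts y Dy). field. exact Ny.
    + rewrite <- (euler_by_parts z Hz). field. exact Z.
Qed.

Lemma euler_ode_vanishing : exists U, forall z, inD z ->
  exists l, Cder U z l /\ (z * l + (1 + b) * U z)%C = G z.
Proof. exists U. exact euler_integral_der. Qed.

End Euler.

Lemma one_plus_neq_0 (b : C) : 0 <= Re b -> (1 + b)%C <> 0%C.
Proof.
  intros Hb E. assert (K : Re (1 + b) = 0) by (rewrite E; reflexivity).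
  unfold Re, Cplus, RtoC in K; simpl in K. unfold Re in Hb. lra.
Qed.

(* Subtracting G(0) makes the kernels continuous at t = 0 even when Re b = 0. *)
Theorem euler_ode b G : 0 <= Re b -> holo G -> exists U, forall z, inD z ->
  exists l, Cder U z l /\ (z * l + (1 + b) * U z)%C = G z.
Proof.
  intros Hb HG.
  destruct (euler_ode_vanishing b (fun z => G z - G 0)%C Hb) as [U HU].
  - intros z Hz. destruct (HG z Hz) as [l Hl]. eexists. apply der_minus; [exact Hl|apply der_const].
  - ring.
  - assert (N := one_plus_neq_0 b Hb).
    exists (fun z => G 0%C / (1 + b) + U z)%C. intros z Hz. destruct (HU z Hz) as [l [Hl E]].
    exists l. split.
    + eapply der_eq; [apply der_plus; [apply der_const|exact Hl]|ring].
    + replace (G z) with (G z - G 0 + G 0)%C by ring. rewrite <- E. field. exact N.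
Qed.

(** * Weights and growth *)

Lemma analytic_holo f : analytic_D f <-> holo f.
Proof.
  split; intros H z Hz; destruct (H z Hz) as [l Hl]; exists l; now apply Cder_is_derive.
Qed.

(** The reciprocal of the weight as a function of the radius. The threshold 1 - 1/e is where - ln (1
    - r) reaches 1, so a maximum replaces the case distinction of [v]. *)
Definition ell (r : R) : R := Rmax 1 (- ln (1 - r)).

Lemma ell_ge_1 r : 1 <= ell r.
Proof. apply Rmax_l. Qed.

Lemma ell_ge_ln r : - ln (1 - r) <= ell r.
Proof. apply Rmax_r. Qed.

Lemma ell_pow_pos r k : 0 < ell r ^ k.
Proof. apply pow_lt. assert (H := ell_ge_1 r). lra. Qed.

Lemma ell_monotone r s : r <= s -> s < 1 -> ell r <= ell s.
Proof.
  intros H1 H2. apply Rmax_lub; [apply ell_ge_1|]. eapply Rle_trans; [|apply ell_ge_ln].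
  assert (K := ln_le (1 - s) (1 - r) ltac:(lra) ltac:(lra)). lra.
Qed.

Lemma v_eq z : inD z -> v z = / ell (Cmod z).
Proof.
  unfold inD. intros H. unfold v, ell. destruct (Rle_dec (Cmod z) (1 - exp (-1))) as [K|K].
  - assert (L := ln_le (exp (-1)) (1 - Cmod z) (exp_pos _) ltac:(lra)). rewrite ln_exp in L.
    rewrite Rmax_left by lra. lra.
  - assert (L := ln_increasing (1 - Cmod z) (exp (-1)) ltac:(lra) ltac:(lra)). rewrite ln_exp in L.
    rewrite Rmax_right by lra. reflexivity.
Qed.

Lemma wbound_iff k f M : wbound k f M <-> forall z, inD z -> Cmod (f z) <= M * ell (Cmod z) ^ k.
Proof.
  split; intros H z Hz; specialize (H z Hz); unfold v_k in *; rewrite v_eq, pow_inv in * by auto;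
    assert (P := ell_pow_pos (Cmod z) k); set (x := ell (Cmod z) ^ k) in *.
  - apply Rmult_le_reg_l with (/ x); [now apply Rinv_0_lt_compat|].
    replace (/ x * (M * x)) with M by (field; lra). exact H.
  - apply Rmult_le_reg_l with x; auto.
    replace (x * (/ x * Cmod (f z))) with (Cmod (f z)) by (field; lra). lra.
Qed.

Lemma wbound_nonneg k f M : wbound k f M -> 0 <= M.
Proof.
  intros H. specialize (H 0%C inD_0). eapply Rle_trans; [|exact H].
  apply Rmult_le_pos; [|apply Cmod_ge_0]. unfold v_k. rewrite v_eq, pow_inv by apply inD_0.
  left. apply Rinv_0_lt_compat, ell_pow_pos.
Qed.

Lemma VH_holo f : VH f -> holo f.
Proof. intros [k [_ [H _]]]. now apply analytic_holo. Qed.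

Lemma VH_bounded f M : holo f -> (forall z, inD z -> Cmod (f z) <= M) -> VH f.
Proof.
  intros Hf H. exists 1%nat. split; [lia|]. split; [now apply analytic_holo|].
  exists M. apply wbound_iff. intros z Hz. eapply Rle_trans; [now apply H|].
  assert (E := ell_ge_1 (Cmod z)). assert (Q := H z Hz). assert (Q' := Cmod_ge_0 (f z)). simpl. nra.
Qed.

(** Logarithmic growth is below every power (1 - r)^(-be): this is 1 + y <= e^y with y = - be ln (1
    - r). *)
Lemma ell_le_power r be : 0 <= r < 1 -> 0 < be ->
  ell r <= Rmax 1 (/ be) * exp (- be * ln (1 - r)).
Proof.
  intros Hr Hb. set (y := - be * ln (1 - r)).
  assert (L := ln_le (1 - r) 1 ltac:(lra) ltac:(lra)). rewrite ln_1 in L.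
  assert (Y : 0 <= y) by (unfold y; nra).
  assert (E : 1 + y <= exp y) by apply exp_ineq1_le.
  assert (M1 := Rmax_l 1 (/ be)). assert (M2 := Rmax_r 1 (/ be)).
  apply Rmax_lub; [nra|].
  assert (Ib : 0 < / be) by now apply Rinv_0_lt_compat.
  replace (- ln (1 - r)) with (/ be * y) by (unfold y; field; lra).
  apply Rmult_le_compat; lra.
Qed.

Lemma exp_INR_mult x n : exp x ^ n = exp (INR n * x).
Proof.
  induction n as [|n IH]; [simpl; rewrite Rmult_0_l, exp_0; reflexivity|].
  rewrite S_INR, <- tech_pow_Rmult, IH, <- exp_plus. f_equal. ring.
Qed.

Lemma VH_decay f al eta : VH f -> 0 < al -> 0 < eta -> exists t0, 0 <= t0 < 1 /\
  forall z, t0 < Cmod z < 1 -> exp (al * ln (1 - Cmod z)) * Cmod (f z) < eta.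
Proof.
  intros [k [Hk [Hf [M HM]]]] Hal Heta. assert (M0 := wbound_nonneg _ _ _ HM).
  assert (Hk' : 0 < INR k) by (apply lt_0_INR; lia).
  (* The k-th power of [ell] then costs (1 - r)^(-al/2), half of the available exponent; the other
     half supplies the smallness. *)
  set (be := al / (2 * INR k)). assert (Hbe : 0 < be) by (apply Rdiv_lt_0_compat; lra).
  set (K := Rmax 1 (/ be)). assert (K1 : 1 <= K) by apply Rmax_l.
  set (N := M * K ^ k). assert (N0 : 0 <= N) by (apply Rmult_le_pos; auto; apply pow_le; lra).
  (* Chosen so that x0^(al/2) = eta / (N + 1); the added 1 avoids a division by 0 when N = 0. *)
  set (x0 := exp (2 / al * ln (eta / (N + 1)))).
  assert (X0 : 0 < x0) by apply exp_pos.
  exists (Rmax 0 (1 - x0)). split.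
  { split; [apply Rmax_l|]. apply Rmax_lub_lt; lra. }
  intros z [Hz1 Hz2]. assert (B1 := Rle_lt_trans _ _ _ (Rmax_l _ _) Hz1).
  assert (B2 := Rle_lt_trans _ _ _ (Rmax_r _ _) Hz1).
  rewrite wbound_iff in HM. specialize (HM z Hz2). set (r := Cmod z) in *.
  set (lx := ln (1 - r)).
  assert (P : ell r ^ k <= K ^ k * exp (- (al / 2) * lx)).
  { apply Rle_trans with ((K * exp (- be * lx)) ^ k).
    - apply pow_incr. split; [assert (H := ell_ge_1 r); lra|]. apply ell_le_power; auto; lra.
    - rewrite Rpow_mult_distr. apply Req_le. f_equal. rewrite exp_INR_mult. f_equal.
      unfold be. field. lra. }
  assert (E : exp (al * lx) = exp (al / 2 * lx) * exp (al / 2 * lx)).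
  { rewrite <- exp_plus. f_equal. field. }
  assert (E' : exp (al / 2 * lx) * exp (- (al / 2) * lx) = 1).
  { rewrite <- exp_plus, <- exp_0. f_equal. ring. }
  assert (S : exp (al / 2 * lx) < eta / (N + 1)).
  { rewrite <- (exp_ln (eta / (N + 1))) by (apply Rdiv_lt_0_compat; lra). apply exp_increasing.
    assert (H : lx < 2 / al * ln (eta / (N + 1))).
    { unfold lx. rewrite <- (ln_exp (2 / al * _)). apply ln_increasing; fold x0; lra. }
    apply Rmult_lt_reg_l with (2 / al); [apply Rdiv_lt_0_compat; lra|].
    replace (2 / al * (al / 2 * lx)) with lx by (field; lra). exact H. }
  set (A := exp (al / 2 * lx)) in *. set (B := exp (- (al / 2) * lx)) in *.
  assert (A0 : 0 < A) by apply exp_pos. assert (B0 : 0 < B) by apply exp_pos.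
  rewrite E. apply Rle_lt_trans with (A * A * (M * (K ^ k * B))).
  - apply Rmult_le_compat_l; [nra|]. eapply Rle_trans; [exact HM|]. now apply Rmult_le_compat_l.
  - replace (A * A * (M * (K ^ k * B))) with (A * N * (A * B)) by (unfold N; ring).
    rewrite E', Rmult_1_r. apply Rle_lt_trans with (eta / (N + 1) * N).
    + apply Rmult_le_compat_r; lra.
    + apply Rmult_lt_reg_r with (N + 1); [lra|].
      replace (eta / (N + 1) * N * (N + 1)) with (eta * N) by (field; lra). nra.
Qed.

(** The equation says that t^(1+b) U(t z) has t-derivative t^b G(t z), so every differentiable
    solution is bounded, however it was constructed. The factor [c] is constant along the ray;
    taking it to be (1 - z)^b allows the quotient estimate for powers inside the hypothesis on G. *)
Lemma euler_solution_bound b c G U z A : 0 <= Re b -> inD z -> 0 <= A ->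
  (forall z, inD z -> exists l, Cder U z l /\ (z * l + (1 + b) * U z)%C = G z) ->
  (forall t, 0 < t <= 1 -> Cmod (c * G (t * z)%C) <= A / (1 - t * Cmod z)) ->
  Cmod (c * U z) <= A * (1 - ln (1 - Cmod z)).
Proof.
  intros Hb Hz HA HU HG. assert (Hz' := Hz). unfold inD in Hz'. set (r := Cmod z) in *.
  assert (r0 : 0 <= r) by apply Cmod_ge_0.
  assert (CU : forall w, inD w -> Ccnt U w).
  { intros w Hw. destruct (HU w Hw) as [l [Hl _]]. exact (der_cnt _ _ _ _ Hl). }
  (* The mean value inequality starts at e > 0, since [tpow] is differentiated only at positive
     arguments; the boundary term there is O(e). *)
  assert (Main : forall e, 0 < e <= 1 ->
    Cmod (c * U z) <= A * (1 - ln (1 - r)) + e * (Cmod c * Cmod (U (e * z)%C))).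
  { intros e He.
    (* The majorant A (t - ln (1 - t r)) has derivative A (1 + r / (1 - t r)), which dominates A /
       (1 - t r) because t <= 1; it also behaves well for r = 0. *)
    assert (M := mean_value_ineq (fun t : R => c * (tpow (1 + b) t * U (t * z)))%C
      (fun t : R => c * (tpow b t * G (t * z)))%C
      (fun t => A * (t - ln (1 - t * r))) (fun t => A * (1 + r / (1 - t * r))) e 1 ltac:(lra)).
    cbv beta in M. rewrite tpow_1, Rmult_1_l in M. replace (1 * U (1 * z))%C with (U z) in M.
    2:{ replace (1 * z)%C with z by ring. ring. }
    assert (X : Cmod (c * U z - c * (tpow (1 + b) e * U (e * z)%C)) <=
      A * (1 - ln (1 - r)) - A * (e - ln (1 - e * r))).
    { apply M.
      - intros t Ht. assert (Dt := inD_scale z t Hz ltac:(lra)). destruct (HU _ Dt) as [l [Hl El]].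
        eapply der_eq.
        + apply der_scal. apply der_mult; [apply Rder_tpow; lra|]. apply Rder_comp_ray. exact Hl.
        + rewrite <- El, tpow_plus_1 by lra. field. intros E. apply RtoC_inj in E. lra.
      - intros t Ht. assert (0 < 1 - t * r) by nra. auto_derive; [lra|]. field. lra.
      - intros t Ht. assert (0 < 1 - t * r) by nra.
        replace (c * (tpow b t * G (t * z)))%C with (tpow b t * (c * G (t * z)%C))%C by ring.
        rewrite Cmod_mult. assert (T := Cmod_tpow_le b t Hb ltac:(lra)).
        assert (T0 := Cmod_ge_0 (tpow b t)).
        assert (HGt := HG t ltac:(lra)). assert (G0 := Cmod_ge_0 (c * G (t * z)%C)).
        apply Rle_trans with (A / (1 - t * r)); [nra|].
        unfold Rdiv at 1. apply Rmult_le_compat_l; auto.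
        replace (/ (1 - t * r)) with (1 + t * r / (1 - t * r)) by (field; lra).
        apply Rplus_le_compat_l. apply Rmult_le_compat_r; [left; now apply Rinv_0_lt_compat|]. nra. }
    assert (Y := Cmod_le_sub (c * U z) (c * (tpow (1 + b) e * U (e * z)%C))).
    assert (Z : 0 <= A * (e - ln (1 - e * r))).
    { apply Rmult_le_pos; auto. assert (L := ln_le (1 - e * r) 1 ltac:(nra) ltac:(nra)).
      rewrite ln_1 in L. lra. }
    assert (W : Cmod (c * (tpow (1 + b) e * U (e * z)%C)) <= e * (Cmod c * Cmod (U (e * z)%C))).
    { rewrite tpow_plus_1 by lra. rewrite !Cmod_mult, Cmod_R, Rabs_pos_eq by lra.
      assert (T := Cmod_tpow_le b e Hb ltac:(lra)).
      assert (Q : 0 <= e * (Cmod c * Cmod (U (e * z)%C))).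
      { apply Rmult_le_pos; [lra|]. apply Rmult_le_pos; apply Cmod_ge_0. }
      replace (Cmod c * (e * Cmod (tpow b e) * Cmod (U (e * z)%C)))
        with (Cmod (tpow b e) * (e * (Cmod c * Cmod (U (e * z)%C)))) by ring.
      assert (T0 := Cmod_ge_0 (tpow b e)). nra. }
    lra. }
  (* The limit e -> 0 is taken by contradiction: U is bounded near 0 by continuity, so a small [e]
     makes the boundary term at most half of the supposed gap. *)
  apply Rnot_lt_le. intros Lt. set (gap := Cmod (c * U z) - A * (1 - ln (1 - r))).
  assert (Hg : 0 < gap) by (unfold gap; lra).
  assert (CR : Rcnt (fun t : R => U (t * z)%C) 0).
  { apply Rcnt_ray. apply CU. replace (0 * z)%C with (RtoC 0) by ring. apply inD_0. }
  destruct (CR 1 Rlt_0_1) as [d [Hd H]].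
  set (B := Cmod c * (Cmod (U (0 * z)%C) + 1)).
  assert (B0 : 0 <= B) by (apply Rmult_le_pos; [apply Cmod_ge_0|assert (Q := Cmod_ge_0 (U (0 * z)%C)); lra]).
  set (e := Rmin (Rmin 1 (d / 2)) (gap / (2 * (B + 1)))).
  assert (e1 : e <= 1) by (unfold e; eapply Rle_trans; [apply Rmin_l|apply Rmin_l]).
  assert (e2 : e <= d / 2) by (unfold e; eapply Rle_trans; [apply Rmin_l|apply Rmin_r]).
  assert (e3 : e <= gap / (2 * (B + 1))) by apply Rmin_r.
  assert (e0 : 0 < e).
  { unfold e. repeat apply Rmin_glb_lt; try lra. apply Rdiv_lt_0_compat; lra. }
  assert (Mn := Main e (conj e0 e1)).
  assert (HUe : Cmod (U (e * z)%C) <= Cmod (U (0 * z)%C) + 1).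
  { assert (K := Cmod_le_sub (U (e * z)%C) (U (0 * z)%C)).
    assert (K2 := H e). rewrite RtoC_sub_mod, Rminus_0_r, Rabs_pos_eq in K2 by lra.
    specialize (K2 ltac:(lra)). lra. }
  assert (HB : Cmod c * Cmod (U (e * z)%C) <= B) by (apply Rmult_le_compat_l; auto; apply Cmod_ge_0).
  assert (F : e * (Cmod c * Cmod (U (e * z)%C)) <= gap / 2).
  { apply Rle_trans with (gap / (2 * (B + 1)) * (B + 1)).
    - apply Rmult_le_compat; try lra. apply Rmult_le_pos; apply Cmod_ge_0.
    - right. field. lra. }
  unfold gap in F. lra.
Qed.

(** * The Cesaro operator *)

Lemma holo_div_one_minus f : holo f -> holo (fun z => f z / (1 - z))%C.
Proof.
  intros Hf z Hz. destruct (Hf z Hz) as [l Hl]. eexists.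
  apply der_mult; [exact Hl|now apply Cder_inv_one_minus].
Qed.

Lemma cesaro_Iseg f z : holo f -> inD z ->
  (z * cesaro f z)%C = Iseg (fun z => f z / (1 - z))%C 0 z.
Proof.
  intros Hf Hz. set (g := fun z => (f z / (1 - z))%C).
  assert (Hc : forall t, 0 <= t <= 1 -> Rcnt (fun t : R => g (t * z)%C) t).
  { intros t Ht. apply Rcnt_ray. apply holo_cnt; [now apply holo_div_one_minus|now apply inD_scale]. }
  assert (HI := Cint_exists _ 0 1 Rle_0_1 Hc). set (I := RInt _ _ _) in HI.
  unfold Iseg, cesaro. destruct (Ceq_dec z 0) as [->|N]; [ring|].
  assert (H1 : Cint (fun t : R => (f (t * z) / (1 - t * z) * z)%C) 0 1 (z * I)).
  { eapply Cint_ext; [lra| |apply (Cint_scal z _ _ _ _ HI)]. intros t _. unfold g. ring. }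
  rewrite (Cint_RInt _ _ _ _ H1).
  replace (fun t : R => g (0 + t * (z - 0))%C) with (fun t : R => g (t * z)%C).
  2:{ apply functional_extensionality. intros t. f_equal. ring. }
  fold I. field. exact N.
Qed.

Lemma cesaro_der f z : holo f -> inD z ->
  Cder (fun z => z * cesaro f z)%C z (f z / (1 - z)).
Proof.
  intros Hf Hz. apply (Cder_ext_D (Iseg (fun z => f z / (1 - z))%C 0)); auto.
  - intros w Hw. symmetry. now apply cesaro_Iseg.
  - exact (primitive_on_disc _ (holo_div_one_minus f Hf) z Hz).
Qed.

(** Lets C f be recognised from a differential equation, without evaluating its integral. *)
Lemma cesaro_eq_primitive f H z : holo f -> inD z ->
  (forall w, inD w -> Cder H w (f w / (1 - w))) -> H 0 = 0%C -> (z * cesaro f z)%C = H z.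
Proof.
  intros Hf Hz HH H0. rewrite cesaro_Iseg by auto.
  rewrite (Cder_Iseg_FTC H); [rewrite H0; ring|].
  intros t Ht. assert (D := inD_segment 0 z t inD_0 Hz Ht). split; [now apply HH|].
  exact (holo_cnt _ (holo_div_one_minus f Hf) _ D).
Qed.

Lemma cesaro_0 f : cesaro f 0 = f 0%C.
Proof. unfold cesaro. destruct (Ceq_dec 0 0); congruence. Qed.

(** * Solvability for Re lambda <= 0 *)

Lemma Re_inv (l : C) : l <> 0%C -> Re (/ l) = Re l / Cmod l ^ 2.
Proof. intros H. rewrite Cmod2_alt. unfold Re, Im, Cinv; simpl. reflexivity. Qed.

(** The constant [c] depends on lam alone, and it is chosen before k, g and M; continuity of the
    inverse on every step rests on its independence of g and M. *)
Lemma cesaro_solvable (lam : C) : lam <> 0%C -> Re lam <= 0 -> exists c, 0 <= c /\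
  forall k g M, holo g -> wbound k g M -> exists f,
    holo f /\ wbound (S k) f (c * M) /\ eqD (shiftop lam cesaro f) g.
Proof.
  intros Hl Hre. set (b := (- / lam)%C).
  assert (Hb0 : b <> 0%C).
  { intros E. apply (f_equal (fun x => - lam * x)%C) in E. unfold b in E.
    replace (- lam * - / lam)%C with (RtoC 1) in E by (field; auto).
    rewrite Cmult_0_r in E. now apply C1_neq_0. }
  assert (Hlb : lam = (- / b)%C) by (unfold b; field; auto).
  assert (Hb : 0 <= Re b).
  { replace (Re b) with (- Re (/ lam)) by reflexivity. rewrite Re_inv by auto.
    assert (P := proj1 (Cmod_gt_0 _) Hl).
    assert (Q : 0 < / Cmod lam ^ 2) by (apply Rinv_0_lt_compat, pow_lt; auto).
    unfold Rdiv. nra. }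
  set (K := Pow_const b). assert (K0 : 0 < K) by apply exp_pos.
  assert (B0 := Cmod_ge_0 b).
  (* The first term bounds - b g. The second bounds b^2 y, with the 2 from 1 - ln (1 - r) <= 2 [ell]
     r. *)
  exists (Cmod b + 2 * (Cmod b * Cmod b) * K). split; [nra|].
  intros k g M Hg HM. assert (M0 := wbound_nonneg _ _ _ HM). rewrite wbound_iff in HM.
  set (G := fun w => (Pow (- b) w * (g w / (1 - w)))%C).
  destruct (euler_ode b G Hb) as [U HU].
  { intros z Hz. destruct (holo_div_one_minus g Hg z Hz) as [l Hl']. eexists.
    apply der_mult; [now apply Cder_Pow|exact Hl']. }
  (* Writing C f = - b y turns lam f - C f = g into f = - b g + b^2 y, and (z C f)' = f / (1 - z)
     into (z y)' = (g - b y) / (1 - z). The factor (1 - z)^b in y reduces the latter to the Euler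
     equation for U. *)
  set (y := fun z => (Pow b z * U z)%C).
  set (f := fun z => (- b * g z + b * b * y z)%C).
  assert (Hy : forall z, inD z -> exists l, Cder y z l /\
    (y z + z * l)%C = (g z / (1 - z) - b * y z / (1 - z))%C).
  { intros z Hz. destruct (HU z Hz) as [l [Hl' E]]. eexists. split.
    - apply der_mult; [now apply Cder_Pow|exact Hl'].
    - assert (N := inD_one_minus_neq_0 z Hz).
      assert (E1 : (Pow b z * G z)%C = (g z / (1 - z))%C).
      { unfold G. rewrite Cmult_assoc, <- Pow_plus. replace (b + - b)%C with (RtoC 0) by ring.
        rewrite Pow_0_l. ring. }
      rewrite <- E1, <- E. unfold y. field. exact N. }
  assert (Hf : holo f).
  { intros z Hz. destruct (Hy z Hz) as [l [Hl' _]]. destruct (Hg z Hz) as [m Hm]. eexists.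
    apply der_plus; apply der_scal; [exact Hm|exact Hl']. }
  assert (Hces : forall z, inD z -> (z * cesaro f z)%C = (- b * (z * y z))%C).
  { intros z Hz. apply (cesaro_eq_primitive f (fun z => - b * (z * y z))%C); auto; [|ring].
    intros w Hw. destruct (Hy w Hw) as [l [Hl' E]]. eapply der_eq.
    - apply der_scal. apply (der_mult (fun z : C => z) (fun z => z)); [apply der_embed|exact Hl'].
    - replace (1 * y w + w * l)%C with (y w + w * l)%C by ring. rewrite E. unfold f.
      field. now apply inD_one_minus_neq_0. }
  exists f. split; [exact Hf|]. split.
  - apply wbound_iff. intros z Hz. set (r := Cmod z).
    assert (r0 : 0 <= r) by apply Cmod_ge_0. assert (r1 : r < 1) by exact Hz.
    set (E := ell r ^ k). assert (E0 : 0 < E) by apply ell_pow_pos.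
    assert (L1 := ell_ge_1 r). assert (L2 := ell_ge_ln r).
    (* Along the ray [ell] is at most its value at z, so the weight leaves the integral as the
       constant [E]; only 1 / (1 - t r) is integrated, and it yields the single extra logarithm. *)
    assert (By : Cmod (y z) <= K * M * E * (1 - ln (1 - r))).
    { apply (euler_solution_bound b (Pow b z) G U z (K * M * E)); auto.
      - apply Rmult_le_pos; [apply Rmult_le_pos|]; lra.
      - intros t Ht. assert (D := inD_scale z t Hz ltac:(lra)). unfold G.
        assert (Pt : 0 < 1 - t * Cmod z) by (fold r; nra).
        replace (Pow b z * (Pow (- b) (t * z) * (g (t * z) / (1 - t * z))))%C
          with ((Pow b z * Pow (- b) (t * z)) * (g (t * z) / (1 - t * z)))%C by ring.
        assert (N := inD_one_minus_neq_0 _ D).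
        rewrite Cmod_mult, Cmod_div by exact N.
        assert (A1 := Cmod_Pow_quotient b z t Hb Hz ltac:(lra)).
        assert (Ct : Cmod (t * z) = t * r) by (rewrite Cmod_mult, Cmod_R, Rabs_pos_eq; auto; lra).
        assert (A2 : Cmod (g (t * z)%C) <= M * E).
        { eapply Rle_trans; [now apply HM|]. apply Rmult_le_compat_l; auto. rewrite Ct.
          apply pow_incr. split; [assert (Q := ell_ge_1 (t * r)); lra|]. apply ell_monotone; nra. }
        assert (A3 : / Cmod (1 - t * z) <= / (1 - t * Cmod z)).
        { apply Rinv_le_contravar; auto. assert (Q := Cmod_one_minus_ge (t * z)). rewrite Ct in Q. exact Q. }
        replace (K * M * E / (1 - t * Cmod z)) with (K * (M * E * / (1 - t * Cmod z))) by (field; lra).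
        apply Rmult_le_compat; auto using Cmod_ge_0.
        + apply Rmult_le_pos; [apply Cmod_ge_0|]. left. apply Rinv_0_lt_compat. now apply Cmod_gt_0.
        + apply Rmult_le_compat; auto using Cmod_ge_0. left. apply Rinv_0_lt_compat. now apply Cmod_gt_0. }
    assert (Bg := HM z Hz). fold r E in Bg.
    unfold f. eapply Rle_trans; [apply Cmod_triangle|]. rewrite !Cmod_mult, Cmod_opp.
    assert (ME : 0 <= M * E) by (apply Rmult_le_pos; lra).
    assert (T1 : Cmod b * Cmod (g z) <= Cmod b * (M * E * ell r)).
    { apply Rmult_le_compat_l; auto. nra. }
    assert (T2 : Cmod b * Cmod b * Cmod (y z) <= Cmod b * Cmod b * (K * M * E * (2 * ell r))).
    { apply Rmult_le_compat_l; [nra|]. eapply Rle_trans; [exact By|]. apply Rmult_le_compat_l; [|lra].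
      apply Rmult_le_pos; [apply Rmult_le_pos|]; lra. }
    eapply Rle_trans; [apply Rplus_le_compat; [exact T1|exact T2]|]. right.
    simpl pow. fold E. ring.
  - intros z Hz. unfold shiftop. destruct (Ceq_dec z 0) as [Z|Z].
    (* Division by z fails here. The value C f(0) = f(0) is consistent because the Euler equation at
       0 reads (1 + b) U(0) = g(0). *)
    + subst z. rewrite cesaro_0. destruct (HU 0%C inD_0) as [l [_ E]].
      assert (E1 : g 0%C = ((1 + b) * U 0%C)%C).
      { replace ((1 + b) * U 0)%C with (0 * l + (1 + b) * U 0)%C by ring. rewrite E. unfold G.
        rewrite Pow_0_r. replace (1 - 0)%C with (RtoC 1) by ring. field. }
      unfold f, y. rewrite E1, Pow_0_r, Hlb. field. exact Hb0.
    + assert (Q := Hces z Hz).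
      replace (cesaro f z) with (- b * y z)%C.
      * unfold f. rewrite Hlb. field. exact Hb0.
      * replace (cesaro f z) with (/ z * (z * cesaro f z))%C by (field; exact Z).
        rewrite Q. field. exact Z.
Qed.

(** * The equation z w' = a w + q along circles and along the positive radius *)

Lemma Rder_circle (r th : R) : Rder (fun th : R => RtoC r * cexp (th * Ci))%C th (Ci * (r * cexp (th * Ci))).
Proof.
  eapply der_eq; [apply der_scal; apply Rder_cexp_ray|]. ring.
Qed.

Lemma Cmod_cexp_Ci (th : R) : Cmod (cexp (th * Ci)) = 1.
Proof.
  rewrite Cmod_cexp. unfold Re, Ci, Cmult, RtoC; simpl.
  replace (th * 0 - 0 * 1) with 0 by ring. apply exp_0.
Qed.

Lemma inD_circle (r th : R) : 0 <= r < 1 -> inD (r * cexp (th * Ci)).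
Proof.
  intros H. unfold inD. rewrite Cmod_mult, Cmod_cexp_Ci, Cmod_R, Rabs_pos_eq; lra.
Qed.

(** In the angle the equation reads dw/dtheta = i (a w + q), and the integrating factor e^(-i a
    theta) removes the term in w. The source q is kept for the resonant case. *)
Lemma Rder_on_circle (a : C) q w (r : R) : 0 <= r < 1 ->
  (forall z, inD z -> exists l, Cder w z l /\ (z * l)%C = (a * w z + q z)%C) -> forall th,
  Rder (fun th : R => w (r * cexp (th * Ci)) * cexp (th * (- (Ci * a))))%C th
    (Ci * q (r * cexp (th * Ci)) * cexp (th * (- (Ci * a))))%C.
Proof.
  intros Hr H th. destruct (H _ (inD_circle r th Hr)) as [l [Hl E]]. eapply der_eq.
  - apply der_mult; [|apply Rder_cexp_ray].
    apply (der_comp RtoC w (fun th : R => r * cexp (th * Ci))%C); [apply Rder_circle|exact Hl].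
  - set (z := (r * cexp (th * Ci))%C) in *.
    replace (l * (Ci * z))%C with (Ci * (z * l))%C by ring. rewrite E. fold z. ring.
Qed.

Lemma cexp_2PI : cexp ((2 * PI)%R * Ci) = 1%C.
Proof.
  unfold cexp, Ci, Cmult, RtoC, Re, Im; simpl.
  replace (2 * PI * 0 - 0 * 1) with 0 by ring. replace (2 * PI * 1 + 0 * 0) with (2 * PI) by ring.
  rewrite exp_0, cos_2PI, sin_2PI. f_equal; ring.
Qed.

Section Homogeneous.
Variables (a : C) (w : C -> C).
Hypothesis Hw : forall z, inD z -> exists l, Cder w z l /\ (z * l)%C = (a * w z)%C.

Let Hw0 : forall z, inD z -> exists l, Cder w z l /\ (z * l)%C = (a * w z + 0)%C.
Proof. intros z Hz. destruct (Hw z Hz) as [l [Hl E]]. exists l. split; auto. rewrite E. ring. Qed.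

Lemma homogeneous_circle (r th : R) : 0 <= r < 1 -> 0 <= th ->
  w (r * cexp (th * Ci))%C = (w r * cexp (th * (Ci * a)))%C.
Proof.
  intros Hr Hth.
  assert (K := Rder_zero_const (fun th : R => w (r * cexp (th * Ci)) * cexp (th * (- (Ci * a))))%C 0 th Hth).
  cbv beta in K. rewrite !Cmult_0_l, cexp_0, !Cmult_1_r in K.
  rewrite <- K.
  - rewrite <- Cmult_assoc, <- cexp_plus.
    replace (th * - (Ci * a) + th * (Ci * a))%C with (RtoC 0) by ring. rewrite cexp_0. ring.
  - intros t Ht. eapply der_eq; [exact (Rder_on_circle a (fun _ => 0%C) w r Hr Hw0 t)|]. cbv beta. ring.
Qed.

Lemma homogeneous_ray (s t : R) : 0 < s <= t -> t < 1 -> (w t * tpow (- a) t)%C = (w s * tpow (- a) s)%C.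
Proof.
  intros Hs Ht. apply (Rder_zero_const (fun t : R => w t * tpow (- a) t)%C s t); [lra|].
  intros u Hu. assert (D : inD u) by (unfold inD; rewrite Cmod_R, Rabs_pos_eq; lra).
  destruct (Hw u D) as [l [Hl E]]. eapply der_eq.
  - apply der_mult; [|apply Rder_tpow; lra].
    apply (der_comp RtoC w RtoC); [apply der_embed|exact Hl].
  - assert (N : RtoC u <> 0%C) by (intros X; apply RtoC_inj in X; lra).
    replace (l * 1)%C with (/ u * (u * l))%C by (field; exact N). rewrite E. field. exact N.
Qed.

Lemma homogeneous_ray_norm (s t : R) : 0 < s <= t -> t < 1 ->
  Cmod (w t) = Cmod (w s) * exp (Re a * (ln t - ln s)).
Proof.
  intros Hs Ht. assert (H := f_equal Cmod (homogeneous_ray s t Hs Ht)).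
  rewrite !Cmod_mult, !Cmod_tpow in H by lra. replace (Re (- a)) with (- Re a) in H by reflexivity.
  replace (Cmod (w t)) with (Cmod (w t) * exp (- Re a * ln t) * exp (Re a * ln t)).
  - rewrite H, Rmult_assoc, <- exp_plus. f_equal. f_equal. ring.
  - rewrite Rmult_assoc, <- exp_plus. replace (- Re a * ln t + Re a * ln t) with 0 by ring.
    rewrite exp_0. ring.
Qed.

Lemma homogeneous_zero : w 0 = 0%C ->
  (0 < Re a -> forall eta, 0 < eta -> exists t0, 0 <= t0 < 1 /\
    forall t, t0 < t < 1 -> Cmod (w t) < eta) ->
  forall z, inD z -> w z = 0%C.
Proof.
  intros W0 Hdecay.
  assert (Hray : forall r, 0 < r < 1 -> w r = 0%C).
  { intros r Hr. apply Cmod_eq_0. apply Rle_antisym; [|apply Cmod_ge_0].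
    apply Rnot_lt_le. intros Pos. destruct (Rlt_dec 0 (Re a)) as [Ha|Ha].
    (* For Re a > 0 the modulus does not decrease towards 1, so a positive value at [r] persists and
       contradicts the decay. *)
    - destruct (Hdecay Ha _ Pos) as [t0 [Ht0 H]].
      assert (M1 := Rmax_l t0 r). assert (M2 := Rmax_r t0 r).
      assert (M3 : Rmax t0 r < 1) by (apply Rmax_lub_lt; lra).
      set (t := (Rmax t0 r + 1) / 2). assert (Ht : t0 < t < 1) by (unfold t; lra).
      specialize (H t Ht). rewrite (homogeneous_ray_norm r t) in H by (unfold t; lra).
      assert (L := ln_le r t ltac:(lra) ltac:(unfold t; lra)).
      assert (E : exp 0 <= exp (Re a * (ln t - ln r))) by (apply exp_le; nra).
      rewrite exp_0 in E. nra.
    (* For Re a <= 0 the modulus does not increase along the radius, so the value at [r] is bounded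
       by values near 0, which tend to w(0) = 0. *)
    - destruct (Hw 0%C inD_0) as [l [Hl _]].
      destruct (der_cnt _ _ _ _ Hl _ Pos) as [d [Hd H]]. rewrite W0 in H.
      set (t := Rmin r (d / 2)).
      assert (T0 : 0 < t) by (unfold t; apply Rmin_glb_lt; lra).
      assert (T1 : t <= r) by apply Rmin_l. assert (T2 : t <= d / 2) by apply Rmin_r.
      specialize (H t). replace (t - 0)%C with (RtoC t) in H by ring.
      replace (w t - 0)%C with (w t) in H by ring.
      rewrite Cmod_R, Rabs_pos_eq in H by lra. specialize (H ltac:(lra)).
      rewrite (homogeneous_ray_norm t r) in H by lra.
      assert (L := ln_le t r T0 T1).
      assert (E : exp (Re a * (ln r - ln t)) <= exp 0) by (apply exp_le; nra).
      rewrite exp_0 in E. assert (Q := Cmod_ge_0 (w t)). nra. }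
  intros z Hz. destruct (Ceq_dec z 0) as [->|Z]; [exact W0|].
  assert (P := proj1 (Cmod_gt_0 _) Z). destruct (polar_form z) as [th E].
  assert (R0 : 0 < Cmod z < 1) by (unfold inD in Hz; lra).
  (* The circle identity is available for nonnegative angles only; adding full turns makes the angle
     nonnegative. *)
  assert (Ang : exists th', 0 <= th' /\ cexp (th' * Ci) = cexp (th * Ci)).
  { destruct (Rle_dec 0 th) as [H|H]; [now exists th|].
    assert (Hper : forall n : nat, cexp ((th + INR n * (2 * PI))%R * Ci) = cexp (th * Ci)).
    { induction n as [|n IH]; [simpl; now rewrite Rmult_0_l, Rplus_0_r|].
      rewrite <- IH, S_INR.
      replace ((th + (INR n + 1) * (2 * PI))%R * Ci)%C
        with ((th + INR n * (2 * PI))%R * Ci + (2 * PI)%R * Ci)%C.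
      - rewrite cexp_plus, cexp_2PI. ring.
      - rewrite <- Cmult_plus_distr_r, <- RtoC_plus. f_equal. f_equal. ring. }
    destruct (INR_unbounded (- th / (2 * PI))) as [n Hn].
    exists (th + INR n * (2 * PI)). split; [|apply Hper].
    assert (PP := PI_RGT_0). apply (Rmult_lt_compat_r (2 * PI)) in Hn; [|lra].
    replace (- th / (2 * PI) * (2 * PI)) with (- th) in Hn by (field; lra). lra. }
  destruct Ang as [th' [H0 E']]. rewrite E, <- E'.
  rewrite homogeneous_circle by lra. rewrite Hray by auto. ring.
Qed.

(** A full turn returns to the same point but multiplies w by e^(2 PI i a). *)
Lemma homogeneous_nonresonant (r : R) : cexp ((2 * PI)%R * (Ci * a)) <> 1%C -> 0 <= r < 1 -> w r = 0%C.
Proof.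
  intros N Hr. assert (PP := PI_RGT_0).
  assert (H := homogeneous_circle r (2 * PI) Hr ltac:(lra)). rewrite cexp_2PI, Cmult_1_r in H.
  destruct (Ceq_dec (w r) 0) as [Z|Z]; auto. exfalso. apply N.
  replace (cexp ((2 * PI)%R * (Ci * a))) with (/ w r * (w r * cexp ((2 * PI)%R * (Ci * a))))%C
    by (field; exact Z).
  rewrite <- H. field. exact Z.
Qed.

End Homogeneous.

(** * Spectrum of the Cesaro operator *)

Lemma Cder_unique f z l m : Cder f z l -> Cder f z m -> l = m.
Proof.
  intros H K. apply Cder_is_derive in H. apply Cder_is_derive in K.
  rewrite <- (is_C_derive_unique f z l H). now apply is_C_derive_unique.
Qed.

Lemma VH_lincomb (al be : C) f g : VH f -> VH g -> VH (fun z => al * f z + be * g z)%C.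
Proof.
  intros [k [Hk [Hf [M HM]]]] [j [Hj [Hg [N HN]]]].
  assert (M0 := wbound_nonneg _ _ _ HM). assert (N0 := wbound_nonneg _ _ _ HN).
  rewrite wbound_iff in HM, HN. rewrite analytic_holo in Hf, Hg.
  exists (k + j)%nat. split; [lia|]. split.
  - apply analytic_holo. intros z Hz. destruct (Hf z Hz) as [l Hl]. destruct (Hg z Hz) as [m Hm].
    eexists. apply der_plus; apply der_scal; eassumption.
  - exists (Cmod al * M + Cmod be * N). apply wbound_iff. intros z Hz.
    specialize (HM z Hz). specialize (HN z Hz). assert (E := ell_ge_1 (Cmod z)).
    set (x := ell (Cmod z)) in *.
    assert (P1 : x ^ k <= x ^ (k + j)) by (apply Rle_pow; auto; lia).
    assert (P2 : x ^ j <= x ^ (k + j)) by (apply Rle_pow; auto; lia).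
    eapply Rle_trans; [apply Cmod_triangle|]. rewrite !Cmod_mult, Rmult_plus_distr_r, !Rmult_assoc.
    apply Rplus_le_compat; (apply Rmult_le_compat_l; [apply Cmod_ge_0|]).
    + eapply Rle_trans; [exact HM|]. now apply Rmult_le_compat_l.
    + eapply Rle_trans; [exact HN|]. now apply Rmult_le_compat_l.
Qed.

(** [p] and [d] stand for C f and f, or for differences C f - C g and f - g; so stated, linearity of
    [cesaro] need not be established. *)
Lemma cesaro_to_euler (lam : C) d p g : lam <> 0%C ->
  (forall z, inD z -> Cder (fun z => z * p z)%C z (d z / (1 - z))) ->
  (forall z, inD z -> (lam * d z - p z)%C = g z) ->
  forall z, inD z -> exists l, Cder (fun z => z * p z * Pow (/ lam) z)%C z l /\
    (z * l)%C = (/ lam * (z * p z * Pow (/ lam) z) + / lam * z * g z * (Pow (/ lam) z / (1 - z)))%C.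
Proof.
  intros Hl Hp Hg z Hz. eexists. split.
  - apply (der_mult (fun z : C => z) (fun z => z * p z)%C); [now apply Hp|now apply Cder_Pow].
  - rewrite <- Hg by auto. field. split; auto. now apply inD_one_minus_neq_0.
Qed.

(** In its uses [p] is built from values of C, and the equation rewrites it on the disc as a
    combination of functions known to be in VH. It is therefore unnecessary to show that C preserves
    VH. *)
Lemma cesaro_euler_decay (a : C) p q : VH q -> (forall z, inD z -> p z = q z) -> 0 < Re a ->
  forall eta, 0 < eta -> exists t0, 0 <= t0 < 1 /\
    forall t : R, t0 < t < 1 -> Cmod (t * p t * Pow a t) < eta.
Proof.
  intros Hq E Ha eta Heta. destruct (VH_decay q (Re a) eta Hq Ha Heta) as [t0 [Ht0 H]].
  exists t0. split; auto. intros t Ht.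
  assert (Ct : Cmod t = t) by (rewrite Cmod_R, Rabs_pos_eq; lra).
  specialize (H t). rewrite Ct in H. specialize (H Ht).
  rewrite E by (unfold inD; lra).
  rewrite !Cmod_mult, Ct, Cmod_Pow_real by lra.
  eapply Rle_lt_trans; [|exact H]. assert (Q := Cmod_ge_0 (q t)).
  assert (X := exp_pos (Re a * ln (1 - t))). set (e := exp _) in *.
  assert (Y : 0 <= e * Cmod (q t)) by (apply Rmult_le_pos; lra).
  replace (t * Cmod (q t) * e) with (t * (e * Cmod (q t))) by ring. nra.
Qed.

Lemma cesaro_injective (lam : C) f g : VH f -> VH g ->
  eqD (shiftop lam cesaro f) (shiftop lam cesaro g) -> eqD f g.
Proof.
  intros Hf Hg E. unfold eqD, shiftop in E.
  set (d := fun z => (1 * f z + - (1) * g z)%C).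
  assert (Vd : VH d) by now apply VH_lincomb.
  set (p := fun z => (cesaro f z - cesaro g z)%C).
  assert (Hp : forall z, inD z -> Cder (fun z => z * p z)%C z (d z / (1 - z))).
  { intros z Hz.
    assert (H := der_minus _ _ _ _ _ _ (cesaro_der f z (VH_holo f Hf) Hz) (cesaro_der g z (VH_holo g Hg) Hz)).
    apply (der_near_ext _ _ (fun z => z * p z)%C z _ 1) in H; [|lra|intros; unfold p; ring].
    eapply der_eq; [exact H|]. unfold d. field. now apply inD_one_minus_neq_0. }
  assert (HE : forall z, inD z -> (lam * d z - p z)%C = 0%C).
  { intros z Hz. specialize (E z Hz). unfold d, p.
    replace (lam * (1 * f z + - (1) * g z) - (cesaro f z - cesaro g z))%C
      with ((lam * f z - cesaro f z) - (lam * g z - cesaro g z))%C by ring.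
    rewrite E. ring. }
  assert (Zp : forall z, inD z -> (z * p z)%C = 0%C).
  { destruct (Ceq_dec lam 0) as [L|L].
    (* For lam = 0 there is no exponent 1 / lam, but the equation itself says p = 0. *)
    - intros z Hz. specialize (HE z Hz). rewrite L in HE.
      replace (z * p z)%C with (- z * (0 * d z - p z))%C by ring. rewrite HE. ring.
    - assert (H := cesaro_to_euler lam d p (fun _ => 0%C) L Hp HE).
      intros z Hz.
      assert (W : (z * p z * Pow (/ lam) z)%C = 0%C).
      { apply (homogeneous_zero (/ lam) (fun z => z * p z * Pow (/ lam) z)%C); auto.
        - intros y Hy. destruct (H y Hy) as [l [Hl El]]. exists l. split; auto. rewrite El. ring.
        - ring.
        - intros Ha. apply (cesaro_euler_decay (/ lam) p (fun z => lam * d z + 0 * d z)%C); auto.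
          + now apply VH_lincomb.
          + intros y Hy. specialize (HE y Hy).
            replace (p y) with (lam * d y - (lam * d y - p y))%C by ring. rewrite HE. ring. }
      replace (z * p z)%C with (z * p z * Pow (/ lam) z * / Pow (/ lam) z)%C
        by (field; apply Pow_neq_0).
      rewrite W. ring. }
  (* Once z p vanishes on the disc, so does its derivative d / (1 - z). *)
  intros z Hz. specialize (Hp z Hz).
  apply (Cder_ext_D _ (fun _ => 0%C)) in Hp; auto.
  assert (D0 := Cder_unique _ _ _ _ Hp (der_const _ 0%C z)).
  assert (N := inD_one_minus_neq_0 z Hz).
  assert (Dz : d z = 0%C).
  { replace (d z) with (d z / (1 - z) * (1 - z))%C by (field; exact N). rewrite D0. ring. }
  unfold d in Dz. replace (f z) with (1 * f z + - (1) * g z + g z)%C by ring. rewrite Dz. ring.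
Qed.

(** [epsilon] selects some solution in VH. Injectivity makes it a left inverse, and makes it agree
    on the disc with the solution bounded in step k + 1, where the seminorm is controlled. *)
Lemma cesaro_resolvent (lam : C) : lam <> 0%C -> Re lam <= 0 -> resolvent_VH cesaro lam.
Proof.
  intros Hl Hre. destruct (cesaro_solvable lam Hl Hre) as [c [Hc Sol]].
  set (Q := fun g f => VH f /\ eqD (shiftop lam cesaro f) g).
  set (Rs := fun g : C -> C => epsilon (inhabits g) (Q g)).
  assert (Ex : forall k g M, (1 <= k)%nat -> holo g -> wbound k g M ->
    exists f, Q g f /\ wbound (S k) f (c * M)).
  { intros k g M Hk Hg HM. destruct (Sol k g M Hg HM) as [f [A [B D]]]. exists f.
    split; auto. split; auto. exists (S k). split; [lia|]. split; [now apply analytic_holo|].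
    now exists (c * M). }
  assert (HS : forall g, VH g -> Q g (Rs g)).
  { intros g [k [Hk [Hg [M HM]]]]. apply epsilon_spec. apply analytic_holo in Hg.
    destruct (Ex k g M Hk Hg HM) as [f [Hf _]]. now exists f. }
  exists Rs. repeat split.
  - intros g Hg. now apply HS.
  - intros g Hg. now apply HS.
  - intros f Hf. set (g := shiftop lam cesaro f).
    assert (K : Q g (Rs g)) by (apply epsilon_spec; exists f; split; auto; intros z _; reflexivity).
    destruct K as [K1 K2]. now apply (cesaro_injective lam).
  - intros q [_ Hq] k Hk. destruct (Hq (S k)) as [c' [Hc' Hq']]; [lia|].
    exists (c' * c). split; [now apply Rmult_le_pos|]. intros g M Hg HM.
    assert (Vg : VH g) by (exists k; split; auto; split; auto; now exists M).
    destruct (HS g Vg) as [V1 V2].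
    destruct (Ex k g M Hk (proj1 (analytic_holo g) Hg) HM) as [f [[F1 F2] F3]].
    assert (E : eqD (Rs g) f).
    { apply (cesaro_injective lam); auto. intros z Hz. rewrite V2, F2; auto. }
    rewrite Rmult_assoc. apply Hq'; [destruct V1 as [? [_ [A _]]]; exact A|].
    intros z Hz. rewrite E by auto. now apply F3.
Qed.

(** * Functions outside the range of lam I - C *)

Lemma INR_S_neq_0 m : (RtoC (INR m) + 1)%C <> 0%C.
Proof.
  rewrite <- RtoC_plus. intros E. apply RtoC_inj in E. assert (H := pos_INR m). lra.
Qed.

Lemma Cder_one_minus_pow n z :
  Cder (fun z => (1 - z) ^ n)%C z (- (INR n * (1 - z) ^ pred n)).
Proof.
  eapply der_eq.
  - apply (der_comp _ (fun z => z ^ n)%C (fun z => 1 - z)%C); [apply Cder_one_minus|apply Cder_pow].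
  - ring.
Qed.

Lemma mul_pow_pred n (z : C) : (z * (INR n * z ^ pred n))%C = (INR n * z ^ n)%C.
Proof. destruct n; simpl; ring. Qed.

(* Adding p/(m+1) z (1-z)^(m+1) to w raises the order of vanishing at 1 of the defect
   z w' - a w by one, without changing w(1). *)
Lemma polynomial_almost_homogeneous (a : C) m : exists (p : C) (w : C -> C), w 1 = 1%C /\
  forall z, exists l, Cder w z l /\ (z * l)%C = (a * w z + p * z * (1 - z) ^ m)%C.
Proof.
  induction m as [|m [p [w [W1 H]]]].
  - exists (1 - a)%C, (fun z => z). split; auto. intros z. exists 1%C. split; [apply der_embed|].
    simpl. ring.
  - set (c := (p / (INR m + 1))%C). assert (N := INR_S_neq_0 m).
    exists (c * (INR m + 2 - a))%C, (fun z => w z + c * (z * (1 - z) ^ S m))%C. split.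
    + rewrite W1. simpl. ring.
    + intros z. destruct (H z) as [l [Hl E]]. eexists. split.
      * apply der_plus; [exact Hl|]. apply der_scal.
        apply (der_mult (fun z : C => z) (fun z => z)); [apply der_embed|apply Cder_one_minus_pow].
      * rewrite Cmult_plus_distr_l, E. simpl pred. rewrite S_INR, RtoC_plus.
        replace p with (c * (INR m + 1))%C by (unfold c; field; exact N).
        simpl Cpow. ring.
Qed.

(** The polynomial z^n - z^n (1 - z)^m has no term in z^n, which is the only power that z d/dz - n
    does not reach. Adding - z^n (1 - z)^(m+1) / (m + 1) passes from m to m + 1. *)
Lemma polynomial_resonant (n m : nat) : exists w : C -> C,
  forall z, exists l, Cder w z l /\ (z * l)%C = (INR n * w z + z ^ n - z ^ n * (1 - z) ^ m)%C.
Proof.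
  induction m as [|m [w H]].
  - exists (fun _ => 0%C). intros z. exists 0%C. split; [apply der_const|]. simpl. ring.
  - set (c := (- / (INR m + 1))%C). assert (N := INR_S_neq_0 m).
    exists (fun z => w z + c * (z ^ n * (1 - z) ^ S m))%C.
    intros z. destruct (H z) as [l [Hl E]]. eexists. split.
    + apply der_plus; [exact Hl|]. apply der_scal.
      apply (der_mult (fun z : C => z) (fun z => z ^ n)%C); [apply Cder_pow|apply Cder_one_minus_pow].
    + rewrite Cmult_plus_distr_l, E. simpl pred. rewrite S_INR, RtoC_plus.
      replace (z * (c * (INR n * z ^ pred n * (1 - z) ^ S m +
          z ^ n * - ((INR m + 1) * (1 - z) ^ m))))%C
        with (c * (z * (INR n * z ^ pred n)) * (1 - z) ^ S m
          - c * (INR m + 1) * z ^ n * z * (1 - z) ^ m)%C by ring.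
      rewrite mul_pow_pred.
      replace (c * (INR m + 1))%C with (- (1))%C by (unfold c; field; exact N).
      simpl Cpow. ring.
Qed.

(** The modulus gives Im a = 0; then cos (2 PI Re a) = 1 becomes sin (PI Re a) = 0 by the half-angle
    formula. *)
Lemma cexp_2PI_resonance (a : C) : 0 < Re a -> cexp ((2 * PI)%R * (Ci * a)) = 1%C ->
  exists m : nat, a = RtoC (INR (S m)).
Proof.
  intros Ha E. assert (PP := PI_RGT_0).
  assert (Ear : ((2 * PI)%R * (Ci * a))%C = (- (2 * PI * Im a), 2 * PI * Re a)).
  { unfold Ci, Cmult, RtoC, Re, Im; simpl. f_equal; ring. }
  rewrite Ear in E.
  assert (I0 : Im a = 0).
  { assert (H := f_equal Cmod E). rewrite Cmod_cexp, Cmod_1 in H. unfold Re in H; simpl in H.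
    rewrite <- exp_0 in H. apply exp_inv in H. nra. }
  assert (H1 : exp (- (2 * PI * Im a)) * cos (2 * PI * Re a) = 1) by exact (f_equal fst E).
  rewrite I0, Rmult_0_r, Ropp_0, exp_0, Rmult_1_l in H1.
  replace (2 * PI * Re a) with (2 * (PI * Re a)) in H1 by ring.
  rewrite cos_2a_sin in H1.
  assert (S0 : sin (PI * Re a) = 0) by nra.
  destruct (sin_eq_0_0 _ S0) as [n Hn].
  assert (Hn' : Re a = IZR n) by (apply Rmult_eq_reg_l with PI; lra).
  assert (0 < n)%Z by (apply lt_IZR; lra).
  exists (pred (Z.to_nat n)). replace (S (pred (Z.to_nat n))) with (Z.to_nat n) by lia.
  rewrite INR_IZR_INZ, Z2Nat.id by lia.
  destruct a as [x y]. unfold Re, Im, RtoC in *; simpl in *. now rewrite Hn', I0.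
Qed.

Lemma cexp_INR n (z : C) : (cexp z ^ n)%C = cexp (INR n * z).
Proof.
  induction n as [|n IH].
  - simpl. now rewrite Cmult_0_l, cexp_0.
  - rewrite S_INR, RtoC_plus. simpl Cpow. rewrite IH, <- cexp_plus. f_equal. ring.
Qed.

Lemma cesaro_not_surjective_nonresonant (lam : C) : 0 < Re (/ lam) -> lam <> 0%C ->
  cexp ((2 * PI)%R * (Ci * / lam)) <> 1%C ->
  exists g, VH g /\ forall f, VH f -> ~ eqD (shiftop lam cesaro f) g.
Proof.
  intros Ha Hl N. set (a := (/ lam)%C) in *.
  assert (Na : a <> 0%C) by (intros X; rewrite X in Ha; unfold Re, RtoC in Ha; simpl in Ha; lra).
  (* With m > Re a the exponent m + 1 - a has positive real part, so [g] below is bounded. *)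
  destruct (INR_unbounded (Re a)) as [m Hm].
  destruct (polynomial_almost_homogeneous a m) as [p [wm [W1 HW]]].
  (* Chosen so that a z g (1 - z)^(a-1) equals the defect p z (1 - z)^m of [wm]; a preimage of g
     would then give [w] differing from [wm] by a homogeneous solution, which vanishes. *)
  set (g := fun z => (p / a * Pow (INR m + 1 - a) z)%C).
  assert (Vg : VH g).
  { apply (VH_bounded g (Cmod (p / a) * Pow_const (INR m + 1 - a))).
    - intros z Hz. eexists. apply der_scal. now apply Cder_Pow.
    - intros z Hz. unfold g. rewrite Cmod_mult. apply Rmult_le_compat_l; [apply Cmod_ge_0|].
      apply Cmod_Pow_bound; auto. unfold Re, Cminus, Cplus, Copp, RtoC in *; simpl in *. lra. }
  exists g. split; [exact Vg|].
  intros f Vf E. set (w := fun z => (z * cesaro f z * Pow a z)%C).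
    assert (Hw := cesaro_to_euler lam f (cesaro f) g Hl (fun z Hz => cesaro_der f z (VH_holo f Vf) Hz) E).
    fold a in Hw.
    assert (Hd : forall r, 0 <= r < 1 -> (w r - wm r)%C = 0%C).
    { intros r Hr. apply (homogeneous_nonresonant a (fun z => w z - wm z)%C); auto.
      intros z Hz. destruct (Hw z Hz) as [l [Hl' El]]. destruct (HW z) as [l' [Hl'' El']].
      exists (l - l')%C. split; [now apply der_minus|].
      replace (z * (l - l'))%C with (z * l - z * l')%C by ring. rewrite El, El'.
      replace (Pow a z / (1 - z))%C with (Pow (a + - (1)) z).
      - unfold g.
        replace (a * z * (p / a * Pow (INR m + 1 - a) z) * Pow (a + - (1)) z)%C
          with (p * z * (Pow (INR m + 1 - a) z * Pow (a + - (1)) z))%C by (field; exact Na).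
        rewrite <- Pow_plus. replace (INR m + 1 - a + (a + - (1)))%C with (RtoC (INR m)) by ring.
        rewrite Pow_nat by auto. unfold w. ring.
      - replace (Pow a z) with (Pow ((a + - (1)) + 1) z) by (f_equal; ring).
        rewrite (Pow_plus (a + - (1)) 1), Pow_1_l by auto. field. now apply inD_one_minus_neq_0. }
    destruct (cesaro_euler_decay a (cesaro f) (fun z => lam * f z + - (1) * g z)%C) with (eta := / 2)
      as [t0 [Ht0 Hdec]]; auto; [now apply VH_lincomb| |lra|].
    { intros z Hz. specialize (E z Hz). unfold shiftop in E. rewrite <- E. ring. }
    destruct (HW 1) as [l [Hl' _]].
    destruct (der_cnt _ _ _ _ Hl' (/ 2) ltac:(lra)) as [d [Hd0 HC]].
    (* A point beyond [t0] and within [d] of 1: there |w| < 1/2 and |wm - 1| < 1/2, although w =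
       wm. *)
    set (t := Rmax ((t0 + 1) / 2) (1 - d / 2)).
    assert (T1 : (t0 + 1) / 2 <= t) by apply Rmax_l. assert (T2 : 1 - d / 2 <= t) by apply Rmax_r.
    assert (T3 : t < 1) by (apply Rmax_lub_lt; lra).
    specialize (Hdec t ltac:(lra)). fold (w t) in Hdec.
    specialize (HC t). rewrite RtoC_sub_mod, Rabs_minus_sym, Rabs_pos_eq in HC by lra.
    specialize (HC ltac:(lra)). rewrite W1 in HC.
    specialize (Hd t ltac:(lra)).
    assert (Ew : w t = wm t) by (apply Cmod_sub_0; rewrite Hd; apply Cmod_0).
    change (Cmod (w t) < / 2) in Hdec. rewrite Ew in Hdec.
    assert (X := Cmod_le_sub 1 (wm t)). rewrite Cmod_1, Cmod_sub_sym in X. lra.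
Qed.

Lemma Cmod_pow_le_1 z m : inD z -> Cmod (z ^ m) <= 1.
Proof.
  intros Hz. rewrite Cmod_pow. unfold inD in Hz. rewrite <- (pow1 m). apply pow_incr.
  assert (Q := Cmod_ge_0 z). lra.
Qed.

(* Here z w' - n w = n z^n forces w e^(-i n theta) to grow linearly in theta on a circle. *)
Lemma cesaro_not_surjective_resonant (lam : C) (m : nat) : lam <> 0%C -> (/ lam)%C = RtoC (INR (S m)) ->
  exists g, VH g /\ forall f, VH f -> ~ eqD (shiftop lam cesaro f) g.
Proof.
  intros Hl Ea. set (a := RtoC (INR (S m))) in *.
  exists (fun z => z ^ m)%C. split.
  - apply (VH_bounded _ 1); [|intros; now apply Cmod_pow_le_1].
    intros z Hz. eexists. apply Cder_pow.
  - intros f Vf E. set (w := fun z => (z * cesaro f z * Pow a z)%C).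
    assert (Hw := cesaro_to_euler lam f (cesaro f) (fun z => z ^ m)%C Hl
      (fun z Hz => cesaro_der f z (VH_holo f Vf) Hz) E).
    rewrite Ea in Hw.
    destruct (polynomial_resonant (S m) m) as [W HW].
    (* Adding a W replaces the source a z^(m+1) (1 - z)^m by the pure power a z^(m+1), whose angular
       factor is cancelled exactly by e^(-i a theta). *)
    set (d := fun z => (w z + a * W z)%C).
    assert (Hd : forall z, inD z -> exists l, Cder d z l /\ (z * l)%C = (a * d z + a * z ^ S m)%C).
    { intros z Hz. destruct (Hw z Hz) as [l [Hl' El]]. destruct (HW z) as [l' [Hl'' El']].
      exists (l + a * l')%C. split; [apply der_plus; [exact Hl'|apply der_scal; exact Hl'']|].
      replace (z * (l + a * l'))%C with (z * l + a * (z * l'))%C by ring. rewrite El, El'.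
      replace (Pow a z / (1 - z))%C with ((1 - z) ^ m)%C.
      - unfold d, w. fold a. simpl Cpow. ring.
      - unfold a. rewrite Pow_nat by auto. simpl Cpow. field. now apply inD_one_minus_neq_0. }
    set (r := / 2). assert (Hr : 0 <= r < 1) by (unfold r; lra).
    assert (K := Rder_on_circle a (fun z => a * z ^ S m)%C d r Hr Hd).
    set (c := (Ci * (a * r ^ S m))%C).
    assert (PP := PI_RGT_0).
    (* With the linear growth theta c subtracted the function is constant. After a full turn the
       first term regains its value because a is an integer, so 2 PI c = 0, whereas c has modulus a
       r^(m+1) > 0. *)
    assert (Z := Rder_zero_const (fun th : R => d (r * cexp (th * Ci)) * cexp (th * (- (Ci * a))) - th * c)%C
      0 (2 * PI) ltac:(lra)).
    assert (Zc : (RtoC (2 * PI) * c)%C = 0%C).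
    { cbv beta in Z. rewrite cexp_2PI, !Cmult_0_l, cexp_0, !Cmult_1_r in Z.
      replace (cexp ((2 * PI)%R * - (Ci * a))) with (RtoC 1) in Z.
      - rewrite Cmult_1_r in Z.
        assert (Z' : (d r - (2 * PI)%R * c)%C = (d r - 0)%C).
        { apply Z. intros t Ht. eapply der_eq.
          - apply der_minus; [apply (K t)|apply Rder_ray].
          - unfold c. rewrite Cpow_mult_l, cexp_INR. fold a.
            replace (Ci * (a * (r ^ S m * cexp (a * (t * Ci)))) * cexp (t * - (Ci * a)))%C
              with (Ci * (a * r ^ S m) * (cexp (a * (t * Ci)) * cexp (t * - (Ci * a))))%C by ring.
            rewrite <- cexp_plus. replace (a * (t * Ci) + t * - (Ci * a))%C with (RtoC 0) by ring.
            rewrite cexp_0. ring. }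
        replace ((2 * PI)%R * c)%C with (d r - (d r - (2 * PI)%R * c))%C by ring. rewrite Z'. ring.
      - replace ((2 * PI)%R * - (Ci * a))%C with (- (a * ((2 * PI)%R * Ci)))%C by ring.
        rewrite cexp_opp. unfold a. rewrite <- cexp_INR, cexp_2PI, Cpow_1_l. field. }
    assert (Mz := f_equal Cmod Zc). unfold c, a in Mz.
    rewrite !Cmod_mult, Cmod_Ci, Cmod_pow, !Cmod_R in Mz.
    rewrite !Rabs_pos_eq in Mz by (try apply pos_INR; try lra).
    assert (X1 : 0 < INR (S m)) by (apply lt_0_INR; lia).
    assert (X2 : 0 < r ^ S m) by (apply pow_lt; unfold r; lra).
    assert (X3 : 0 < 2 * PI * (1 * (INR (S m) * r ^ S m))).
    { apply Rmult_lt_0_compat; [lra|]. rewrite Rmult_1_l. now apply Rmult_lt_0_compat. }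
    lra.
Qed.

(* U = log(1+z)/z is mapped by C^(-1) to (1-z)/(1+z), which has a pole at -1. *)
Lemma cesaro_not_surjective_0 : exists g, VH g /\ forall f, VH f -> ~ eqD (shiftop 0 cesaro f) g.
Proof.
  assert (N : forall z, inD z -> (1 + z)%C <> 0%C).
  { intros z Hz. replace (1 + z)%C with (1 - - z)%C by ring. apply inD_one_minus_neq_0.
    unfold inD. now rewrite Cmod_opp. }
  (* With b = 0 the equation reads (z U)' = 1 / (1 + z); this provides log (1 + z) / z already
     differentiable at 0. *)
  destruct (euler_ode 0 (fun z => / (1 + z))%C) as [U HU].
  { unfold Re, RtoC; simpl. lra. }
  { intros z Hz. eexists. apply (der_inv _ (fun z => 1 + z)%C); [now apply N|].
    apply der_plus; [apply der_const|apply der_embed]. }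
  exists U. split.
  - exists 1%nat. split; [lia|]. split.
    + apply analytic_holo. intros z Hz. destruct (HU z Hz) as [l [Hl _]]. now exists l.
    (* The source is bounded by 1 / (1 - t |z|), so A = 1, and 1 - ln (1 - r) <= 2 [ell] r. *)
    + exists 2. apply wbound_iff. intros z Hz.
      assert (B := euler_solution_bound 0 1 (fun z => / (1 + z))%C U z 1).
      rewrite Cmult_1_l in B. eapply Rle_trans; [apply B|]; auto; try lra.
      * unfold Re, RtoC; simpl. lra.
      * intros t Ht. assert (D := inD_scale z t Hz ltac:(lra)).
        rewrite Cmult_1_l, Cmod_inv by now apply N. unfold Rdiv. rewrite Rmult_1_l.
        unfold inD in Hz. assert (Q := Cmod_ge_0 z).
        apply Rinv_le_contravar; [nra|].
        assert (X := Cmod_one_minus_ge (- (t * z))). rewrite Cmod_opp, Cmod_mult, Cmod_R, Rabs_pos_eq in X by lra.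
        replace (1 - - (t * z))%C with (1 + t * z)%C in X by ring. exact X.
      * assert (L1 := ell_ge_1 (Cmod z)). assert (L2 := ell_ge_ln (Cmod z)). simpl. lra.
  - intros f Vf E.
    assert (Hf : forall z, inD z -> f z = (- ((1 - z) / (1 + z)))%C).
    { intros z Hz. assert (H1 := cesaro_der f z (VH_holo f Vf) Hz).
      destruct (HU z Hz) as [l [Hl El]].
      apply (Cder_ext_D _ (fun z => - (1) * (z * U z))%C) in H1; auto.
      - assert (H2 : Cder (fun z => - (1) * (z * U z))%C z (- (1) * (1 * U z + z * l))).
        { apply der_scal. apply (der_mult (fun z : C => z) (fun z => z)); [apply der_embed|exact Hl]. }
        assert (Q := Cder_unique _ _ _ _ H1 H2).
        replace (1 * U z + z * l)%C with (z * l + (1 + 0) * U z)%C in Q by ring. rewrite El in Q.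
        assert (N1 := inD_one_minus_neq_0 z Hz). assert (N2 := N z Hz).
        replace (f z) with (f z / (1 - z) * (1 - z))%C by (field; exact N1). rewrite Q. field. exact N2.
      - intros y Hy. specialize (E y Hy). unfold shiftop in E. rewrite <- E. ring. }
    (* At z = - t the product (1 - t) |f(- t)| equals 1 + t, so it cannot fall below 1 as membership
       in VH would require. *)
    destruct (VH_decay f 1 1 Vf Rlt_0_1 Rlt_0_1) as [t0 [Ht0 H]].
    set (t := (t0 + 1) / 2). assert (Ht : t0 < t < 1) by (unfold t; lra).
    specialize (H (- RtoC t)%C). rewrite Cmod_opp, Cmod_R, Rabs_pos_eq in H by lra.
    specialize (H Ht). rewrite Rmult_1_l, exp_ln in H by lra.
    rewrite Hf in H by (unfold inD; rewrite Cmod_opp, Cmod_R, Rabs_pos_eq; lra).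
    replace (1 - - RtoC t)%C with (RtoC (1 + t)) in H by (rewrite RtoC_plus; ring).
    replace (1 + - RtoC t)%C with (RtoC (1 - t)) in H by (rewrite RtoC_minus; ring).
    rewrite Cmod_opp, Cmod_div, !Cmod_R, !Rabs_pos_eq in H by (try lra; intros X; apply RtoC_inj in X; lra).
    replace ((1 - t) * ((1 + t) / (1 - t))) with (1 + t) in H by (field; lra). lra.
Qed.

Lemma cesaro_not_resolvent (lam : C) : lam = 0%C \/ 0 < Re lam -> ~ resolvent_VH cesaro lam.
Proof.
  intros Hl [Rs [S1 [S2 _]]].
  assert (G : exists g, VH g /\ forall f, VH f -> ~ eqD (shiftop lam cesaro f) g).
  { destruct Hl as [-> | Hl]; [apply cesaro_not_surjective_0|].
    assert (L : lam <> 0%C) by (intros X; rewrite X in Hl; unfold Re, RtoC in Hl; simpl in Hl; lra).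
    assert (Ha : 0 < Re (/ lam)).
    { rewrite Re_inv by auto. apply Rdiv_lt_0_compat; auto. apply pow_lt. now apply Cmod_gt_0. }
    destruct (Ceq_dec (cexp ((2 * PI)%R * (Ci * / lam))) 1) as [E|E].
    - destruct (cexp_2PI_resonance _ Ha E) as [m Em]. now apply (cesaro_not_surjective_resonant lam m).
    - now apply cesaro_not_surjective_nonresonant. }
  destruct G as [g [Vg H]]. apply (H (Rs g)); auto.
Qed.

Theorem theorem2p4 :
  (forall lam : C, ~ point_spectrum_VH cesaro lam) /\
  (forall lam : C, spectrum_VH cesaro lam <-> (lam = 0%C \/ 0 < Re lam)).
Proof.
  split.
  - intros lam [f [g [Hf [Hg [N E]]]]]. apply N. now apply (cesaro_injective lam).
  - intros lam. split; [|apply cesaro_not_resolvent].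
    intros H. apply NNPP. intros K. apply H. apply cesaro_resolvent.
    + intros X. apply K. now left.
    + apply Rnot_lt_le. intros X. apply K. now right.
Qed.
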